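(* Let $(E,\langle\cdot,\cdot\rangle,\pi,[\cdot,\cdot])$ be an odd exact Courant algebroid over an $n$-dimensional manifold $M$. i) Let $\mathcal F$ be a $B_n$-generalized complex structure on $E$ with $i$-eigenbundle $L$. Any two $B_n$-complex generalized connections $D,\tilde D$ (i.e. torsion-free generalized connections on $E$ with $D\mathcal F=\tilde D\mathcal F=0$) are related by $$\tilde D=D+\mathrm{Re}\,(\mathrm{sk}\,\eta),$$ where $\eta\in\Gamma(S^2L^*\otimes\bar L^* )$. ii) Let $(G,\mathcal F)$ be a $B_n$-generalized pseudo-Kähler structure on $E$. Any two $B_n$-Kähler generalized connections $D,\tilde D$ (i.e. torsion-free generalized connections on $E$ preserving both $G$ and $\mathcal F$) are related by $$\tilde D=D+\mathrm{Re}\left(\mathrm{sk}\,(\eta_++\eta_-)\right),$$ where $\eta_\pm\in\Gamma(S^2E_{\pm,\mathcal F}^*\otimes\bar E_{\pm,\mathcal F}^* )$.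
   Context: A Courant algebroid over a smooth manifold $M$ is a real vector bundle $E\to M$ with a non-degenerate symmetric bilinear form $\langle\cdot,\cdot\rangle$ (scalar product), a bundle map $\pi:E\to TM$ (anchor) and an $\mathbb R$-bilinear bracket $[\cdot,\cdot]$ on $\Gamma(E)$ (Dorfman bracket) such that for all $u,v,w\in\Gamma(E)$, $f\in C^\infty(M)$: $[u,[v,w]]=[[u,v],w]+[v,[u,w]]$; $[u,fv]=f[u,v]+\pi(u)(f)v$; $\pi(u)\langle v,w\rangle=\langle[u,v],w\rangle+\langle v,[u,w]\rangle$; $\langle[u,v]+[v,u],w\rangle=\pi(w)\langle u,v\rangle$. With $n=\dim M$, it is odd exact (of type $B_n$) if $\pi$ is surjective and $\langle\cdot,\cdot\rangle$ has signature $(n+1,n)$ (so $\mathrm{rank}\,E=2n+1$). All structures are extended complex-linearly to $E^{\mathbb C}=E\otimes\mathbb C$. A generalized connection on $E$ is an $\mathbb R$-linear map $D:\Gamma(E)\to\Gamma(E^*\otimes E)$, $u\mapsto Du$, with $D_v(fu)=\pi(v)(f)u+fD_vu$ and $\pi(w)\langle u,v\rangle=\langle D_wu,v\rangle+\langle u,D_wv\rangle$. Its torsion $T^D\in\Gamma(\Lambda^3E^* )$ is $T^D(u,v,w)=\langle D_uv-D_vu-[u,v],w\rangle+\langle D_wu,v\rangle$; torsion-free means $T^D=0$. $D$ is extended to tensors as usual. For $S\in\Gamma(E^*\otimes\Lambda^2E^* )$, $D+S$ denotes the generalized connection with $\langle(D+S)_uv,w\rangle=\langle D_uv,w\rangle+S(u,v,w)$.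 A $B_n$-generalized almost complex structure on $E$ is a $\langle\cdot,\cdot\rangle$-skew-symmetric endomorphism $\mathcal F$ of $E$ of rank $2n$ with $\mathcal F^2=-\mathrm{Id}+(-1)^n\langle\cdot,u_0\rangle u_0$ for a section $u_0\in\Gamma(E)$ with $\langle u_0,u_0\rangle=(-1)^n$. It is integrable (a $B_n$-generalized complex structure) if the sections of its $i$-eigenbundle $L\subset E^{\mathbb C}$ are closed under the Dorfman bracket. Put $U:=\mathrm{Ker}\,\mathcal F=\mathrm{span}(u_0)$. A generalized (admissible) metric is a subbundle $E_-\subset E$ on which $\langle\cdot,\cdot\rangle$ is non-degenerate and such that $\pi|_{E_-}:E_-\to TM$ is an isomorphism; $E_+:=(E_-)^\perp$, $G^{\mathrm{end}}|_{E_\pm}=\pm\mathrm{Id}$, $G(u,v)=\langle G^{\mathrm{end}}u,v\rangle$. A $B_n$-generalized pseudo-Kähler structure is a pair $(G,\mathcal F)$ of a generalized metric $G$ and a $B_n$-generalized almost complex structure $\mathcal F$ with $G^{\mathrm{end}}\mathcal F=\mathcal FG^{\mathrm{end}}$ such that $\mathcal F$ and $G^{\mathrm{end}}\mathcal F$ (which is again a $B_n$-generalized almost complex structure) are both integrable. Put $E_{\pm,\mathcal F}:=E_\pm^{\mathbb C}\cap L$. The map $\mathrm{sk}:S^2(E^{\mathbb C})^*\otimes(E^{\mathbb C})^*\to(E^{\mathbb C})^*\otimes\Lambda^2(E^{\mathbb C})^*$ is $(\mathrm{sk}\,\sigma)(u,v,w):=\sigma(u,v,w)-\sigma(u,w,v)$.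 The sections $\eta,\eta_\pm$ are regarded as sections of $S^2(E^{\mathbb C})^*\otimes(E^{\mathbb C})^*$ (extension by zero) via the decompositions $E^{\mathbb C}=L\oplus\bar L\oplus U^{\mathbb C}$ and $E^{\mathbb C}=E_{+,\mathcal F}\oplus\bar E_{+,\mathcal F}\oplus E_{-,\mathcal F}\oplus\bar E_{-,\mathcal F}\oplus U^{\mathbb C}$ respectively. For $\sigma\in\Gamma((E^{\mathbb C})^*\otimes\Lambda^2(E^{\mathbb C})^* )$, $\mathrm{Re}\,\sigma\in\Gamma(E^*\otimes\Lambda^2E^* )$ maps $u,v,w\in\Gamma(E)$ to the real part of $\sigma(u,v,w)$. *)

(* Defs.v *)
From HB Require Import structures.
From mathcomp Require Import all_boot all_order all_algebra.
From mathcomp Require Import all_classical all_reals all_analysis.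
From mathcomp.real_closed Require Import complex.

Set Implicit Arguments.
Unset Strict Implicit.
Unset Printing Implicit Defensive.
Import Order.TTheory GRing.Theory Num.Theory.
Import numFieldNormedType.Exports.
Local Open Scope classical_set_scope.
Local Open Scope ring_scope.

Fixpoint Ck (R : realType) (n k : nat) (W : set 'rV[R]_n)
    (f : 'rV[R]_n -> R) : Prop :=
  (forall x, W x -> {for x, continuous f}) /\
  (if k is k'.+1 then
     forall i : 'I_n, (forall x, W x -> derivable f x (delta_mx 0 i)) /\
       Ck k' W (fun x => 'D_(delta_mx 0 i) f x)
   else True).

Definition Cinfty (R : realType) (n : nat) (W : set 'rV[R]_n)
    (f : 'rV[R]_n -> R) : Prop := forall k, Ck k W f.

Section CkTheory.
Variables (R : realType) (n : nat).
Implicit Types (W : set 'rV[R]_n) (f g : 'rV[R]_n -> R).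

Lemma Ck_cont k W f x : Ck k W f -> W x -> {for x, continuous f}.
Proof. by case: k => [|k] [+ _]; apply. Qed.

Lemma near_eq_continuous W f g x : open W -> W x ->
  (forall y, W y -> f y = g y) -> {for x, continuous g} ->
  {for x, continuous f}.
Proof.
move=> oW Wx fg cg; rewrite /prop_for /continuous_at (fg x Wx).
have : \forall y \near nbhs x, g y = f y.
  by apply: filterS (open_nbhs_nbhs (conj oW Wx)) => y /fg.
by move=> /near_eq_cvg gf; exact: cvg_trans gf cg.
Qed.

Lemma Ck_loc k W f :
  (forall x, W x -> exists W' g, [/\ open W', W' x, Ck k W' g &
     forall y, W' y -> f y = g y]) -> Ck k W f.
Proof.
elim: k W f => [|k IH] W f H; split=> //.
- move=> x /H [W' [g [oW W'x [cg _] fg]]].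
  exact: near_eq_continuous oW W'x fg (cg x W'x).
- move=> x /H [W' [g [oW W'x [cg _] fg]]].
  exact: near_eq_continuous oW W'x fg (cg x W'x).
- move=> i; split.
    move=> x /H [W' [g [oW W'x [cg /(_ i) [dg _]] fg]]].
    apply: near_eq_derivable (dg x W'x).
    by apply: filterS (open_nbhs_nbhs (conj oW W'x)) => y /fg.
  apply: IH => x /H [W' [g [oW W'x [cg /(_ i) [dg Cg]] fg]]].
  exists W', (fun x => 'D_(delta_mx 0 i) g x); split=> // y W'y.
  apply: near_eq_derive.
  by apply: filterS (open_nbhs_nbhs (conj oW W'y)) => z /fg.
Qed.

Lemma Ck_ext k W f g : (forall y, f y = g y) -> Ck k W g -> Ck k W f.
Proof. by move=> /funext ->. Qed.

Lemma Ck_sub k W W' f : W' `<=` W -> Ck k W f -> Ck k W' f.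
Proof.
move=> sW; elim: k f => [|k IH] f [cf df]; split=> //; try by move=> x /sW /cf.
move=> i; have [d1 d2] := df i.
by split; [move=> x /sW /d1|exact: IH].
Qed.

Lemma Ck_le k W f : Ck k.+1 W f -> Ck k W f.
Proof.
elim: k f => [|k IH] f [cf df]; split=> // i.
by have [d1 d2] := df i; split=> //; exact: IH.
Qed.

Lemma Ck_cst k W (a : R) : Ck k W (fun=> a).
Proof.
elim: k a => [|k IH] a; split=> //; try by move=> x _; exact: cst_continuous.
move=> i; split; first by move=> x _; apply: derivable_cst.
by apply: Ck_ext (IH 0) => y; rewrite derive_cst.
Qed.

Lemma Ck_add k W f g : open W -> Ck k W f -> Ck k W g -> Ck k W (f \+ g).
Proof.
move=> oW; elim: k f g => [|k IH] f g Hf Hg; split=> //;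
  try by move=> x Wx; apply: continuousD; [exact: Ck_cont Hf Wx|exact: Ck_cont Hg Wx].
move=> i; move: Hf Hg => [_ /(_ i) [df Cf]] [_ /(_ i) [dg Cg]]; split.
  by move=> x Wx; apply: derivableD; [exact: df|exact: dg].
apply: Ck_loc => x Wx.
exists W, ('D_(delta_mx 0 i) f \+ 'D_(delta_mx 0 i) g); split=> //.
  exact: IH Cf Cg.
by move=> y Wy; rewrite /= deriveD//; [exact: df|exact: dg].
Qed.

Lemma Ck_mul k W f g : open W -> Ck k W f -> Ck k W g -> Ck k W (f \* g).
Proof.
move=> oW; elim: k f g => [|k IH] f g Hf Hg; split=> //;
  try by move=> x Wx; apply: continuousM; [exact: Ck_cont Hf Wx|exact: Ck_cont Hg Wx].
have [Lf Lg] := (Ck_le Hf, Ck_le Hg).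
move=> i; move: Hf Hg => [_ /(_ i) [df Cf]] [_ /(_ i) [dg Cg]]; split.
  by move=> x Wx; apply: derivableM; [exact: df|exact: dg].
apply: Ck_loc => x Wx.
exists W, ((f \* 'D_(delta_mx 0 i) g) \+ (g \* 'D_(delta_mx 0 i) f)); split=> //.
  by apply: Ck_add => //; apply: IH.
by move=> y Wy; rewrite /= deriveM//; [exact: df|exact: dg].
Qed.

End CkTheory.

Record chart (R : realType) (n : nat) (T : topologicalType) := Chart {
  chart_dom : set T;
  chart_map :> T -> 'rV[R]_n;
  chart_inv : 'rV[R]_n -> T;
  chart_dom_open : open chart_dom;
  chart_img_open : open (chart_map @` chart_dom);
  chart_mapK : forall x, chart_dom x -> chart_inv (chart_map x) = x;
  chart_map_cont : forall x, chart_dom x -> {for x, continuous chart_map};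
  chart_inv_cont : forall y, (chart_map @` chart_dom) y ->
    {for y, continuous chart_inv} }.

Record smooth_manifold (R : realType) (n : nat) := SmoothManifold {
  mf_space :> topologicalType;
  mf_hausdorff : hausdorff_space mf_space;
  mf_second_countable : @second_countable mf_space;
  mf_atlas : set (chart R n mf_space);
  mf_cover : forall x, exists2 c, mf_atlas c & chart_dom c x;
  mf_compat : forall c c', mf_atlas c -> mf_atlas c' -> forall j : 'I_n,
    Cinfty (c @` (chart_dom c `&` chart_dom c'))
      (fun y => c' (chart_inv c y) 0 j) }.

(* U is always an open set below *)
Definition smooth_on (R : realType) (n : nat) (M : smooth_manifold R n)
    (U : set M) (f : M -> R) : Prop :=
  forall c, mf_atlas c ->
    Cinfty (c @` (chart_dom c `&` U)) (fun y => f (chart_inv c y)).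

Section SmoothOnTheory.
Variables (R : realType) (n : nat) (M : smooth_manifold R n).
Implicit Types (U V : set M) (f g : M -> R).

Lemma chart_open_image (c : chart R n M) U : open U ->
  open (c @` (chart_dom c `&` U)).
Proof.
move=> oU.
rewrite openE => y [p [dp Up] <-].
have im : (c @` chart_dom c) (c p) by exists p.
have n1 : nbhs (c p) (c @` chart_dom c).
  by apply: open_nbhs_nbhs; split=> //; exact: chart_img_open.
have n2 : nbhs (c p) (chart_inv c @^-1` U).
  apply: (chart_inv_cont im); rewrite chart_mapK//.
  exact: open_nbhs_nbhs.
apply: filterS (filterI n1 n2) => z [[q dq <-]] /=.
by rewrite chart_mapK// => Uq; exists q.
Qed.

Lemma smooth_on_loc U f :
  (forall p, U p -> exists V g, [/\ open V, V p, smooth_on V g &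
     forall q, V q -> f q = g q]) -> smooth_on U f.
Proof.
move=> H c ac k; apply: Ck_loc => y [p [dp Up] <-].
have [V [g [oV Vp sg fg]]] := H p Up.
exists (c @` (chart_dom c `&` V)), (fun y => g (chart_inv c y)); split.
- exact: chart_open_image.
- by exists p.
- exact: sg.
- by move=> z [q [dq Vq] <-]; rewrite chart_mapK// fg.
Qed.

Lemma smooth_on_sub U V f : V `<=` U -> smooth_on U f -> smooth_on V f.
Proof.
move=> VU sf c ac k; apply: Ck_sub (sf c ac k).
by move=> y [p [dp Vp] <-]; exists p => //; split=> //; exact: VU.
Qed.

Lemma smooth_on_cst U (a : R) : smooth_on U (fun=> a).
Proof. by move=> c ac k; exact: Ck_cst. Qed.

Lemma smooth_on_add U f g : open U -> smooth_on U f -> smooth_on U g ->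
  smooth_on U (f \+ g).
Proof.
move=> oU sf sg c ac k.
by apply: (Ck_add _ (sf c ac k) (sg c ac k)); exact: chart_open_image.
Qed.

Lemma smooth_on_mul U f g : open U -> smooth_on U f -> smooth_on U g ->
  smooth_on U (f \* g).
Proof.
move=> oU sf sg c ac k.
by apply: (Ck_mul _ (sf c ac k) (sg c ac k)); exact: chart_open_image.
Qed.

Lemma smooth_on_sum U (I : Type) (r : seq I) (F : I -> M -> R) : open U ->
  (forall i, smooth_on U (F i)) -> smooth_on U (fun p => \sum_(i <- r) F i p).
Proof.
move=> oU sF; elim: r => [|i r IH].
  by under eq_fun do rewrite big_nil; exact: smooth_on_cst.
by under eq_fun do rewrite big_cons; exact: (smooth_on_add oU (sF i) IH).
Qed.

Definition smooth_pred : {pred M -> R} := fun f => `[< smooth_on setT f >].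

Lemma smooth_predP f : reflect (smooth_on setT f) (f \in smooth_pred).
Proof. exact: asboolP. Qed.

Fact smooth_subring_closed : subring_closed smooth_pred.
Proof.
split.
- by apply/(@smooth_predP 1); exact: smooth_on_cst.
- move=> f g /smooth_predP sf /smooth_predP sg; apply/smooth_predP.
  have -> : f - g = f \+ ((fun=> -1) \* g).
    by apply/funext => p /=; rewrite mulN1r.
  apply: smooth_on_add => //; first exact: openT.
  by apply: smooth_on_mul => //; [exact: openT|exact: smooth_on_cst].
- move=> f g /smooth_predP sf /smooth_predP sg; apply/smooth_predP.
  by apply: smooth_on_mul => //; exact: openT.
Qed.

Record smooth_fun := SmoothFun {
  smooth_fun_val :> M -> R;
  smooth_fun_in : smooth_fun_val \in smooth_pred }.

HB.instance Definition _ := [isSub for smooth_fun_val].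
HB.instance Definition _ := [Choice of smooth_fun by <:].
HB.instance Definition _ := GRing.SubChoice_isSubComPzRing.Build
  (M -> R) smooth_pred smooth_fun smooth_subring_closed.

Lemma smooth_funP (f : smooth_fun) : smooth_on setT f.
Proof. by have /smooth_predP := smooth_fun_in f. Qed.

Definition mk_smooth_fun (f : M -> R) (sf : smooth_on setT f) : smooth_fun :=
  @SmoothFun f (introT (smooth_predP f) sf).

Definition const_fun (a : R) : smooth_fun :=
  mk_smooth_fun (smooth_on_cst setT a).

End SmoothOnTheory.
Arguments smooth_fun {R n} M.

(* T_p M is the space of derivations at p of the algebra C^infty(M). *)
Record tangent (R : realType) (n : nat) (M : smooth_manifold R n) (p : M) :=
  Tangent {
  tangent_act :> smooth_fun M -> R;
  tangent_linear : forall (a : R) (f g : smooth_fun M),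
    tangent_act (const_fun M a * f + g) = a * tangent_act f + tangent_act g;
  tangent_leibniz : forall f g : smooth_fun M,
    tangent_act (f * g) = f p * tangent_act g + tangent_act f * g p }.

Record local_frame (R : realType) (n : nat) (M : smooth_manifold R n)
    (V : M -> vectType R) (r : nat) := LocalFrame {
  frame_dom : set M;
  frame :> forall p, r.-tuple (V p);
  frame_open : open frame_dom;
  frame_basis : forall p, frame_dom p -> basis_of fullv (frame p) }.

(* A vector bundle of rank r is given by its fibres and an atlas of local
   frames, i.e. of local trivialisations. *)
Record vbundle (R : realType) (n : nat) (M : smooth_manifold R n) (r : nat) :=
  VBundle {
  vb_fibre :> M -> vectType R;
  vb_atlas : set (local_frame vb_fibre r);
  vb_cover : forall p, exists2 t, vb_atlas t & frame_dom t p;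
  vb_compat : forall t t', vb_atlas t -> vb_atlas t' -> forall i j : 'I_r,
    smooth_on (frame_dom t `&` frame_dom t')
      (fun p => coord (t p) i (t' p)`_j) }.

Section Sections.
Variables (R : realType) (n : nat) (M : smooth_manifold R n) (r : nat).
Variable E : vbundle M r.

Definition smooth_section_on (U : set M) (s : forall p, E p) : Prop :=
  forall t, vb_atlas t -> forall i : 'I_r,
    smooth_on (U `&` frame_dom t) (fun p => coord (t p) i (s p)).

Record section := Section {
  section_val :> forall p, E p;
  section_smooth : smooth_section_on setT section_val }.

Lemma section_eq (u v : section) : (forall p, u p = v p) -> u = v.
Proof.
case: u v => [u su] [v sv] /= uv.
have e : u = v by apply: functional_extensionality_dep.
by subst v; congr Section; exact: Prop_irrelevance.
Qed.

HB.instance Definition _ := gen_eqMixin section.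
HB.instance Definition _ := gen_choiceMixin section.

Lemma setTI_open t : @vb_atlas _ _ _ _ E t -> open (setT `&` frame_dom t).
Proof. by move=> _; rewrite setTI; exact: frame_open. Qed.

Fact section0_subproof : smooth_section_on setT (fun p => 0 : E p).
Proof.
by move=> t _ i; under eq_fun do rewrite linear0; exact: smooth_on_cst.
Qed.

Fact section_add_subproof (u v : section) :
  smooth_section_on setT (fun p => u p + v p).
Proof.
move=> t at_ i; under eq_fun do rewrite linearD.
by apply: smooth_on_add (section_smooth u at_ i) (section_smooth v at_ i);
  exact: setTI_open.
Qed.

Fact section_scale_subproof (f : smooth_fun M) (u : section) :
  smooth_section_on setT (fun p => f p *: u p).
Proof.
move=> t at_ i; under eq_fun do rewrite linearZ.
have sf : smooth_on (setT `&` frame_dom t) f.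
  exact: smooth_on_sub (smooth_funP f).
by apply: smooth_on_mul sf (section_smooth u at_ i); exact: setTI_open.
Qed.

Fact section_opp_subproof (u : section) :
  smooth_section_on setT (fun p => - u p).
Proof.
move=> t at_ i; under eq_fun do rewrite linearN -mulN1r.
apply: smooth_on_mul (smooth_on_cst _ _) (section_smooth u at_ i).
exact: setTI_open.
Qed.

Definition section0 := Section section0_subproof.
Definition section_add u v := Section (section_add_subproof u v).
Definition section_opp u := Section (section_opp_subproof u).
Definition section_scale f u := Section (section_scale_subproof f u).

Fact section_addA : associative section_add.
Proof. by move=> u v w; apply: section_eq => p /=; rewrite addrA. Qed.
Fact section_addC : commutative section_add.
Proof. by move=> u v; apply: section_eq => p /=; rewrite addrC. Qed.
Fact section_add0 : left_id section0 section_add.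
Proof. by move=> u; apply: section_eq => p /=; rewrite add0r. Qed.
Fact section_addN : left_inverse section0 section_opp section_add.
Proof. by move=> u; apply: section_eq => p /=; rewrite addNr. Qed.

HB.instance Definition _ := GRing.isZmodule.Build section
  section_addA section_addC section_add0 section_addN.

Fact section_scaleA f g u :
  section_scale f (section_scale g u) = section_scale (f * g) u.
Proof. by apply: section_eq => p /=; rewrite scalerA. Qed.
Fact section_scale1 : left_id 1 section_scale.
Proof. by move=> u; apply: section_eq => p /=; rewrite scale1r. Qed.
Fact section_scaleDr : right_distributive section_scale +%R.
Proof. by move=> f u v; apply: section_eq => p /=; rewrite scalerDr. Qed.
Fact section_scaleDl u : {morph section_scale^~ u : f g / f + g}.
Proof. by move=> f g; apply: section_eq => p /=; rewrite scalerDl. Qed.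

HB.instance Definition _ := GRing.Zmodule_isLmodule.Build (smooth_fun M) section
  section_scaleA section_scale1 section_scaleDr section_scaleDl.

Record endo_field := EndoField {
  endo_val :> forall p, 'End(E p);
  endo_smooth : forall t, vb_atlas t -> forall i j : 'I_r,
    smooth_on (frame_dom t) (fun p => coord (t p) i (endo_val p (t p)`_j)) }.

Fact endo_app_subproof (A : endo_field) (u : section) :
  smooth_section_on setT (fun p => A p (u p)).
Proof.
move=> t at_ i; apply: smooth_on_loc => p [_ tp].
exists (setT `&` frame_dom t), (fun q => \sum_(j < r)
  coord (t q) j (u q) * coord (t q) i (A q (t q)`_j)); split=> //.
- exact: setTI_open.
- apply: smooth_on_sum => [|j]; first exact: setTI_open.
  apply: smooth_on_mul (section_smooth u at_ j) _; first exact: setTI_open.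
  by rewrite setTI; exact: endo_smooth.
- move=> q [_ tq] /=.
  rewrite {1}(coord_basis (frame_basis tq) (memvf (u q))) !linear_sum /=.
  by apply: eq_bigr => j _; rewrite !linearZ.
Qed.

Definition endo_app (A : endo_field) (u : section) : section :=
  Section (endo_app_subproof A u).

Record scalar_product := ScalarProduct {
  sp_form :> forall p, {biscalar (E p)};
  sp_sym : forall p (x y : E p), sp_form p x y = sp_form p y x;
  sp_nondeg : forall p (x : E p), (forall y, sp_form p x y = 0) -> x = 0;
  sp_smooth : forall t, vb_atlas t -> forall i j : 'I_r,
    smooth_on (frame_dom t) (fun p => sp_form p (t p)`_i (t p)`_j) }.

Fact inner_subproof (g : scalar_product) (u v : section) :
  smooth_on setT (fun p => g p (u p) (v p)).
Proof.
apply: smooth_on_loc => p _; have [t at_ tp] := vb_cover E p.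
exists (setT `&` frame_dom t), (fun q => \sum_(i < r) \sum_(j < r)
  coord (t q) i (u q) * (coord (t q) j (v q) * g q (t q)`_i (t q)`_j)).
have oU := setTI_open at_; split=> //.
- apply: smooth_on_sum => // i; apply: smooth_on_sum => // j.
  apply: smooth_on_mul (section_smooth u at_ i) _ => //.
  apply: smooth_on_mul (section_smooth v at_ j) _ => //.
  by rewrite setTI; exact: sp_smooth.
- move=> q [_ tq] /=.
  rewrite {1}(coord_basis (frame_basis tq) (memvf (u q))) linear_sumlz /=.
  apply: eq_bigr => i _; rewrite linearZl_LR /=.
  rewrite {1}(coord_basis (frame_basis tq) (memvf (v q))) linear_sumr /=.
  by rewrite mulr_sumr; apply: eq_bigr => j _; rewrite linearZr_LR.
Qed.

Definition inner (g : scalar_product) (u v : section) : smooth_fun M :=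
  mk_smooth_fun (inner_subproof g u v).

(* A bundle map E -> TM. It is smooth when it maps smooth sections of E to
   smooth vector fields, and a vector field X is smooth iff X f is smooth for
   all f in C^infty(M). *)
Record anchor_map := AnchorMap {
  anchor_val :> forall p, E p -> tangent p;
  anchor_linear : forall p (a : R) (x y : E p) (f : smooth_fun M),
    anchor_val (a *: x + y) f = a * anchor_val x f + anchor_val y f;
  anchor_smooth : forall (u : section) (f : smooth_fun M),
    smooth_on setT (fun p => anchor_val (u p) f) }.

Definition anchor_act (pi : anchor_map) (u : section) (f : smooth_fun M) :
  smooth_fun M := mk_smooth_fun (anchor_smooth pi u f).

End Sections.

Record courant_algebroid (R : realType) (n : nat) (M : smooth_manifold R n)
    (r : nat) := CourantAlgebroid {
  ca_bundle :> vbundle M r;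
  ca_sp : scalar_product ca_bundle;
  ca_anchor : anchor_map ca_bundle;
  ca_bracket : section ca_bundle -> section ca_bundle -> section ca_bundle;
  ca_linearl : forall (a : R) (u v w : section ca_bundle),
    ca_bracket (const_fun M a *: u + v) w =
    const_fun M a *: ca_bracket u w + ca_bracket v w;
  ca_linearr : forall (a : R) (u v w : section ca_bundle),
    ca_bracket u (const_fun M a *: v + w) =
    const_fun M a *: ca_bracket u v + ca_bracket u w;
  ca_jacobi : forall u v w : section ca_bundle,
    ca_bracket u (ca_bracket v w) =
    ca_bracket (ca_bracket u v) w + ca_bracket v (ca_bracket u w);
  ca_leibniz : forall (u v : section ca_bundle) (f : smooth_fun M),
    ca_bracket u (f *: v) =
    f *: ca_bracket u v + anchor_act ca_anchor u f *: v;
  ca_metric : forall u v w : section ca_bundle,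
    anchor_act ca_anchor u (inner ca_sp v w) =
    inner ca_sp (ca_bracket u v) w + inner ca_sp v (ca_bracket u w);
  ca_sym : forall u v w : section ca_bundle,
    inner ca_sp (ca_bracket u v + ca_bracket v u) w =
    anchor_act ca_anchor w (inner ca_sp u v) }.

Definition has_signature (R : realType) (V : vectType R) (B : V -> V -> R)
    (a b : nat) : Prop :=
  exists e : (a + b).-tuple V, basis_of fullv e /\
    forall i j : 'I_(a + b), B e`_i e`_j =
      if i == j then (if (i < a)%N then 1 else -1) else 0.

Section Complexification.
Variable R : realType.

(* V (x) C, the pair (x, y) standing for x + iy *)
Definition cplx (V : lmodType R) : Type := (V * V)%type.

Variable V : lmodType R.

HB.instance Definition _ := GRing.Zmodule.copy (cplx V) (V * V)%type.

Definition cplx_scale (a : R[i]) (z : cplx V) : cplx V :=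
  (complex.Re a *: z.1 - complex.Im a *: z.2,
   complex.Re a *: z.2 + complex.Im a *: z.1).

Fact cplx_scaleA a b (z : cplx V) :
  cplx_scale a (cplx_scale b z) = cplx_scale (a * b) z.
Proof.
case: a b z => [a a'] [b b'] [x y]; rewrite /cplx_scale /=.
congr pair; rewrite !scalerDr !scalerDl ?scalerN ?scaleNr !scalerA ?opprD.
  by rewrite [X in _ + X = _]addrC addrACA.
by rewrite [X in _ + X = _]addrC addrACA.
Qed.

Fact cplx_scale1 : left_id 1 cplx_scale.
Proof.
by case=> x y; rewrite /cplx_scale /= !scale1r !scale0r subr0 addr0.
Qed.

Fact cplx_scaleDr : right_distributive cplx_scale +%R.
Proof.
move=> a [x y] [x' y']; rewrite /cplx_scale /=; congr pair => /=.
  by rewrite !scalerDr opprD addrACA.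
by rewrite !scalerDr addrACA.
Qed.

Fact cplx_scaleDl z : {morph cplx_scale^~ z : a b / a + b}.
Proof.
case: z => x y [a a'] [b b']; rewrite /cplx_scale /=; congr pair => /=.
  by rewrite !scalerDl opprD addrACA.
by rewrite !scalerDl addrACA.
Qed.

HB.instance Definition _ := GRing.Zmodule_isLmodule.Build R[i] (cplx V)
  cplx_scaleA cplx_scale1 cplx_scaleDr cplx_scaleDl.

Definition cplx_inj (x : V) : cplx V := (x, 0).

Definition cplx_conj (z : cplx V) : cplx V := (z.1, - z.2).

Definition cplx_map (f : V -> V) (z : cplx V) : cplx V := (f z.1, f z.2).

End Complexification.

Section Courant.
Variables (R : realType) (n : nat) (M : smooth_manifold R n) (r : nat).
Variable E : courant_algebroid M r.

Local Notation sect := (section E).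
Local Notation "<| u , v |>" := (inner (ca_sp E) u v).
Local Notation "[| u , v |]" := (@ca_bracket _ _ _ _ E u v).
Local Notation act := (anchor_act (ca_anchor E)).

Definition odd_exact : Prop :=
  (forall p (X : tangent p), exists x : E p,
     forall f, ca_anchor E p x f = X f) /\
  (forall p, has_signature (ca_sp E p) n.+1 n).

Record gen_connection := GenConnection {
  gc_val :> sect -> endo_field E;
  gc_linear : forall (a : R) (u v : sect) (p : M),
    gc_val (const_fun M a *: u + v) p = a *: gc_val u p + gc_val v p;
  gc_leibniz : forall (u v : sect) (f : smooth_fun M),
    endo_app (gc_val (f *: u)) v = act v f *: u + f *: endo_app (gc_val u) v;
  gc_metric : forall u v w : sect,
    act w <| u, v |> = <| endo_app (gc_val u) w, v |>
                     + <| u, endo_app (gc_val v) w |> }.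

(* D_v u; the generalized connection itself maps u to Du : v |-> D_v u *)
Definition cov (D : gen_connection) (v u : sect) : sect := endo_app (D u) v.

Definition torsion (D : gen_connection) (u v w : sect) : smooth_fun M :=
  <| cov D u v - cov D v u - [| u, v |], w |> + <| cov D w u, v |>.

Definition torsion_free (D : gen_connection) : Prop :=
  forall u v w, torsion D u v w = 0.

(* (D_v A) u for an endomorphism field A *)
Definition cov_endo (D : gen_connection) (A : endo_field E) (v u : sect) : sect :=
  cov D v (endo_app A u) - endo_app A (cov D v u).

Definition preserves_endo (D : gen_connection) (A : endo_field E) : Prop :=
  forall v u, cov_endo D A v u = 0.

(* Complex sections of E are pairs (u, v) of sections, standing for u + iv. *)
Definition csection : Type := (sect * sect)%type.

Definition csection_at (s : csection) (p : M) : cplx (E p) := (s.1 p, s.2 p).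

Definition cbracket (s t : csection) : csection :=
  ([| s.1, t.1 |] - [| s.2, t.2 |], [| s.1, t.2 |] + [| s.2, t.1 |]).

(* families of subsets of the fibres of the complexification of E *)
Definition csub : Type := forall p : M, set (cplx (E p)).

Definition i_eigen (A : forall p, 'End(E p)) : csub :=
  fun p => [set z | cplx_map (A p) z = 'i%C *: z].

Definition csub_conj (L : csub) : csub := fun p => [set z | L p (cplx_conj z)].

Definition cker (A : forall p, 'End(E p)) : csub :=
  fun p => [set z | cplx_map (A p) z = 0].

Definition integrable (A : forall p, 'End(E p)) : Prop :=
  forall s t : csection,
    (forall p, i_eigen A (csection_at s p)) ->
    (forall p, i_eigen A (csection_at t p)) ->
    forall p, i_eigen A (csection_at (cbracket s t) p).

Definition Bn_almost_complex (F : endo_field E) : Prop :=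
  [/\ forall p (x y : E p), ca_sp E p (F p x) y = - ca_sp E p x (F p y),
      forall p, \dim (limg (F p)) = (2 * n)%N &
      exists u0 : sect,
        (forall p, ca_sp E p (u0 p) (u0 p) = (-1) ^+ n) /\
        (forall p (x : E p),
           F p (F p x) = - x + ((-1) ^+ n * ca_sp E p x (u0 p)) *: u0 p)].

Definition Bn_complex (F : endo_field E) : Prop :=
  Bn_almost_complex F /\ integrable F.

Definition Bn_complex_connection (F : endo_field E) (D : gen_connection) : Prop :=
  torsion_free D /\ preserves_endo D F.

Definition smooth_subbundle (S : forall p, {vspace (E p)}) : Prop :=
  forall p, exists (W : set M) (s : 'I_(\dim (S p)) -> forall q, E q),
    [/\ open W, W p, forall i, smooth_section_on W (s i) &
        forall q, W q -> basis_of (S q) [seq s i q | i <- enum 'I_(\dim (S p))]].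

(* gm_neg is E_- and gm_end is G^end. The latter is determined by the former,
   since the fibres of E are the sums of E_- and its orthogonal, and its
   smoothness follows from that of E_-. *)
Record gen_metric := GenMetric {
  gm_neg : forall p, {vspace (E p)};
  gm_neg_smooth : smooth_subbundle gm_neg;
  gm_neg_nondeg : forall p x, x \in gm_neg p ->
    (forall y, y \in gm_neg p -> ca_sp E p x y = 0) -> x = 0;
  gm_neg_anchor : forall p (X : tangent p), exists! x : E p,
    x \in gm_neg p /\ forall f, ca_anchor E p x f = X f;
  gm_end : endo_field E;
  gm_end_neg : forall p x, x \in gm_neg p -> gm_end p x = - x;
  gm_end_pos : forall p x, (forall y, y \in gm_neg p -> ca_sp E p x y = 0) ->
    gm_end p x = x }.

Definition metric_form (G : gen_metric) (u v : sect) : smooth_fun M :=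
  <| endo_app (gm_end G) u, v |>.

Definition preserves_metric (D : gen_connection) (G : gen_metric) : Prop :=
  forall w u v, act w (metric_form G u v)
    - metric_form G (cov D w u) v - metric_form G u (cov D w v) = 0.

Definition pseudo_Kahler (G : gen_metric) (F : endo_field E) : Prop :=
  [/\ Bn_almost_complex F,
      forall p x, gm_end G p (F p x) = F p (gm_end G p x),
      integrable F &
      integrable (fun p => gm_end G p \o F p)%VF].

Definition Bn_Kahler_connection (G : gen_metric) (F : endo_field E)
    (D : gen_connection) : Prop :=
  [/\ torsion_free D, preserves_metric D G & preserves_endo D F].

(* E_+ for s = true and E_- for s = false *)
Definition gm_part (G : gen_metric) (s : bool) (p : M) : set (E p) :=
  if s then [set x | forall y, y \in gm_neg G p -> ca_sp E p x y = 0]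
  else [set x | x \in gm_neg G p].

Definition gm_part_L (G : gen_metric) (F : endo_field E) (s : bool) : csub :=
  fun p => [set z | [/\ gm_part G s z.1, gm_part G s z.2 & i_eigen F z]].

(* E^C = L + Lbar + U^C *)
Inductive L_summand := SumL | SumLbar | SumU.

Definition L_decomp (F : endo_field E) (a : L_summand) : csub :=
  match a with
  | SumL => i_eigen F
  | SumLbar => csub_conj (i_eigen F)
  | SumU => cker F
  end.

(* E^C = E_{+,F} + conj E_{+,F} + E_{-,F} + conj E_{-,F} + U^C *)
Inductive Kahler_summand := KSum of bool | KSumbar of bool | KSumU.

Definition Kahler_decomp (G : gen_metric) (F : endo_field E)
    (a : Kahler_summand) : csub :=
  match a with
  | KSum s => gm_part_L G F s
  | KSumbar s => csub_conj (gm_part_L G F s)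
  | KSumU => cker F
  end.

Definition cform3 : Type :=
  forall p : M, cplx (E p) -> cplx (E p) -> cplx (E p) -> R[i].

Definition ctrilinear (eta : cform3) : Prop :=
  forall p (a : R[i]) (x x' y z : cplx (E p)),
    [/\ eta p (a *: x + x') y z = a * eta p x y z + eta p x' y z,
        eta p y (a *: x + x') z = a * eta p y x z + eta p y x' z &
        eta p y z (a *: x + x') = a * eta p y z x + eta p y z x'].

Definition csmooth (eta : cform3) : Prop :=
  forall t, @vb_atlas _ _ _ _ E t -> forall i j k : 'I_r,
    let c p := eta p (cplx_inj (t p)`_i) (cplx_inj (t p)`_j)
                     (cplx_inj (t p)`_k) in
    smooth_on (frame_dom t) (fun p => complex.Re (c p)) /\
    smooth_on (frame_dom t) (fun p => complex.Im (c p)).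

(* Sections of S^2 A^* (x) B^*, where A = dec a and B = dec b are summands of
   the decomposition dec of the complexification of E, extended by zero on the
   other summands to sections of S^2 (E^C)^* (x) (E^C)^* *)
Definition S2_section (I : Type) (dec : I -> csub) (a b : I) (eta : cform3) : Prop :=
  [/\ ctrilinear eta,
      csmooth eta,
      forall p x y z, eta p x y z = eta p y x z,
      forall c, c <> a -> forall p x y z, dec c p x -> eta p x y z = 0 &
      forall c, c <> b -> forall p x y z, dec c p z -> eta p x y z = 0].

Definition sk (eta : cform3) : cform3 :=
  fun p x y z => eta p x y z - eta p x z y.

Definition Re_form (sigma : cform3) (p : M) (x y z : E p) : R :=
  complex.Re (sigma p (cplx_inj x) (cplx_inj y) (cplx_inj z)).

(* D' = D + S *)
Definition shifted_by (D D' : gen_connection)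
    (S : forall p, E p -> E p -> E p -> R) : Prop :=
  forall (u v w : sect) (p : M),
    <| cov D' u v, w |> p = <| cov D u v, w |> p + S p (u p) (v p) (w p).

End Courant.

(* Main.v *)
(* The difference S(u,v,w) = <D'_u v - D_u v, w> is skew in v, w, has vanishing
   cyclic sum (equality of torsions), and satisfies S(u,Fv,w) = - S(u,v,Fw).
   Hence S vanishes as soon as one argument is in U = span(u0), and S(u,.,.)
   pairs L only with Lbar.  The cyclic identity then makes S(x,y,zbar)
   symmetric in x, y in L, and eta(x,y,z) = 2 S(P x, P y, Pbar z), where
   P = (- F^2 - i F)/2 and Pbar are the projections onto L and Lbar, satisfies
   S = Re (sk eta).  If the connections also preserve G, then S splits as the
   sum of its restrictions to E_+ and E_-, to which the same formula applies.
   That S is a tensor at points, and that eta is smooth, rests on the extension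
   of local sections by bump functions. *)
Require Import Defs.
From HB Require Import structures.
From mathcomp Require Import all_boot all_order all_algebra.
From mathcomp Require Import all_classical all_reals all_analysis.
From mathcomp.real_closed Require Import complex.
From mathcomp Require Import ring lra.

Set Implicit Arguments.
Unset Strict Implicit.
Unset Printing Implicit Defensive.
Import Order.TTheory GRing.Theory Num.Theory.
Import numFieldNormedType.Exports.
Local Open Scope classical_set_scope.
Local Open Scope ring_scope.

(** * Bump functions and extension of sections *)

Section FlatFunction.
Variable R : realType.

(* t^-m exp(-1/t) for t > 0: this family is stable under differentiation up to
   linear combinations, whence the smoothness of exp(-1/t). *)
Definition flat (m : nat) (t : R) : R :=
  if 0 < t then t^-1 ^+ m * expR (- t^-1) else 0.

Lemma flat_gt0 m t : (0 < flat m t) = (0 < t).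
Proof.
rewrite /flat; case: ifP => t0; last by rewrite ltxx.
by rewrite mulr_gt0 ?expR_gt0// exprn_gt0 ?invr_gt0.
Qed.

Lemma flat_le0 m t : t <= 0 -> flat m t = 0.
Proof. by rewrite /flat leNgt => /negbTE ->. Qed.

Lemma flat_ge0 m t : 0 <= flat m t.
Proof.
case: (ltP 0 t) => t0; last by rewrite flat_le0.
by rewrite ltW// flat_gt0.
Qed.

(** The inequality [exp s >= s^(m+1) / (m+1)!] at [s = 1/t]. A bound linear in [t] is what
    continuity at 0 requires. *)
Lemma flat_le m t : flat m t <= m.+1`!%:R * `|t|.
Proof.
case: (ltP 0 t) => t0; last by rewrite flat_le0// mulr_ge0.
rewrite /flat t0 gtr0_norm// expRN ler_pdivrMr ?expR_gt0//.
have s0 : 0 < t^-1 by rewrite invr_gt0.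
have := expR_ge1Dxn m (ltW s0); move: (expR _) => e He.
rewrite exprS in He.
have f0 : 0 < m.+1`!%:R :> R by rewrite ltr0n fact_gt0.
have {}He : t^-1 * t^-1 ^+ m / m.+1`!%:R <= e by lra.
rewrite ler_pdivrMr// in He.
have -> : t^-1 ^+ m = t * (t^-1 * t^-1 ^+ m) by rewrite mulrA divff ?mul1r// gt_eqF.
have -> : m.+1`!%:R * t * e = t * (e * m.+1`!%:R) by ring.
by rewrite ler_pM2l.
Qed.

(** Exhibits [flat m.+1] as the difference quotient of [flat m] at 0. *)
Lemma flatS m t : flat m t = t * flat m.+1 t.
Proof.
rewrite /flat; case: ifP => t0; last by rewrite mulr0.
by rewrite exprS !mulrA divff ?mul1r// gt_eqF.
Qed.

Lemma flat_continuous0 m : {for 0, continuous (flat m)}.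
Proof.
apply/cvgrPdist_le => e e0; rewrite flat_le0//.
have f0 : 0 < m.+1`!%:R :> R by rewrite ltr0n fact_gt0.
near=> s; rewrite sub0r normrN ger0_norm ?flat_ge0// (le_trans (flat_le m s))//.
rewrite mulrC -ler_pdivlMr//; near: s.
have ef0 : 0 < e / m.+1`!%:R by rewrite divr_gt0.
have := @nbhs_ball_norm _ _ (0 : R) (PosNum ef0).
by apply: filterS => s /=; rewrite /ball_ /= sub0r normrN => /ltW.
Unshelve. all: by end_near. Qed.

Lemma is_derive_flat m (t : R) :
  is_derive t 1 (flat m) (- m%:R * flat m.+1 t + flat m.+2 t).
Proof.
have [t0|t0|->] := ltgtP t 0.
- rewrite !flat_le0 ?(ltW t0)// mulr0 addr0.
  have e : {near t, cst 0 =1 flat m}.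
    by apply: filterS (lt_nbhsl t0) => s s0; rewrite flat_le0// ltW.
  split; first by apply: near_eq_derivable e _; exact: derivable_cst.
  by rewrite -(@near_eq_derive _ R R _ _ t 1 e) derive_cst.
- have tn0 : t != 0 by rewrite gt_eqF.
  pose i (s : R) := s^-1.
  have e : {near t, (i ^+ m) * (expR \o (- i)) =1 flat m}.
    apply: filterS (lt_nbhsr t0) => s s0.
    by rewrite /flat s0 !fctE /=.
  have dV : is_derive t 1 i (- t ^- 2).
    have h := @is_deriveV R id t 1 1 tn0 (is_derive_id _ _).
    by apply: is_derive_eq h _; rewrite /GRing.scale /= mulr1.
  have dX := is_deriveX m dV.
  have dE : is_derive t 1 (expR \o (- i)) (expR (- t^-1) * t ^- 2).
    have dN : is_derive t 1 (- i) (t ^- 2).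
      by apply: is_derive_eq (is_deriveN dV) _; rewrite opprK.
    exact: is_derive1_comp.
  have [d1 d2] := is_deriveM dX dE.
  split; first exact: near_eq_derivable e d1.
  rewrite -(@near_eq_derive _ R R _ _ t 1 e) d2 /flat t0 /GRing.scale /= !fctE /i.
  case: m {e dX d1 d2} => [|m] /=.
    by rewrite !mul0r mulr0 oppr0 mul0r !add0r addr0 !expr0 mul1r exprVn mulrC.
  by rewrite -exprVn !exprS !expr0; ring.
- rewrite !flat_le0// mulr0 addr0.
  (* Caratheodory's criterion: the slope at 0 extends continuously by [flat m.+1], whose value at 0
     is the claimed derivative 0. *)
  apply/is_derive1_caratheodory; exists (flat m.+1); split.
  + by move=> z; rewrite (flat_le0 m (lexx 0)) !subr0 mulrC -flatS.
  + exact: flat_continuous0.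
  + by rewrite flat_le0.
Qed.
End FlatFunction.

(** * Composition with [flat] and inversion of C^k functions *)

Section CkMore.
Variables (R : realType) (n : nat).
Implicit Types (W : set 'rV[R]_n) (f : 'rV[R]_n -> R).

Lemma derive_line (V : normedModType R) (f : V -> R) (x v : V) :
  'D_v f x = 'D_1 (fun h : R => f (h *: v + x)) 0.
Proof.
rewrite /derive; set g1 := fun h => h^-1 *: _; set g2 := fun h => h^-1 *: _.
suff -> : g1 = g2 by [].
by apply/funext => h; rewrite /g1 /g2 /= addr0 scale0r add0r [_%:A]mulr1.
Qed.

(** Only a directional derivative of [f] is given, not differentiability, so the one-variable chain
    rule is applied along the line through [x] in direction [v]. *)
Lemma is_derive_comp_real (V : normedModType R) (f : V -> R) (g : R -> R)
    (x v : V) (a b : R) :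
  is_derive (f x) 1 g a -> is_derive x v f b -> is_derive x v (g \o f) (a * b).
Proof.
move=> dg [df <-]; pose l (h : R) := f (h *: v + x).
have dl : is_derive (0 : R) (1 : R) l ('D_v f x).
  split; first exact: (derivable1P f x v).1 df.
  exact: esym (derive_line f x v).
have l0 : l 0 = f x by rewrite /l scale0r add0r.
have [d1 d2] : is_derive (0 : R) (1 : R) (g \o l) (a * 'D_v f x).
  by apply: is_derive1_comp; rewrite l0.
split; first exact: (derivable1P (g \o f) x v).2 d1.
exact: etrans (derive_line (g \o f) x v) d2.
Qed.

(** Induction on [k] for all [m] at once, since differentiating [flat m] brings in [flat m.+1] and
    [flat m.+2]. *)
Lemma Ck_flat k m W f : open W -> Ck k W f -> Ck k W (flat m \o f).
Proof.
move=> oW; elim: k m f => [|k IH] m f Ckf.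
  split=> // x Wx; apply: continuous_comp; first exact: Ck_cont Ckf Wx.
  apply: differentiable_continuous; apply/derivable1_diffP.
  by have [] := is_derive_flat m (f x).
split.
  move=> x Wx; apply: continuous_comp; first exact: Ck_cont Ckf Wx.
  apply: differentiable_continuous; apply/derivable1_diffP.
  by have [] := is_derive_flat m (f x).
have Lf := Ck_le Ckf; move: Ckf => [_ df] i; have {df} [df Cf] := df i.
have D x : W x -> is_derive x (delta_mx 0 i) (flat m \o f)
    ((- m%:R * flat m.+1 (f x) + flat m.+2 (f x)) * 'D_(delta_mx 0 i) f x).
  move=> Wx; apply: is_derive_comp_real (is_derive_flat m (f x)) _.
  exact/derivableP/df.
split; first by move=> x /D [].
apply: Ck_loc => x Wx; exists W, (fun y => (- m%:R * flat m.+1 (f y) +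
  flat m.+2 (f y)) * 'D_(delta_mx 0 i) f y); split => //.
- apply: (Ck_mul oW _ Cf); apply: (Ck_add oW); last exact: IH.
  exact: (Ck_mul oW (Ck_cst _ _ _) (IH _ _ Lf)).
- by move=> y /D [].
Qed.

Lemma Ck_inv k W f : open W -> (forall x, W x -> f x != 0) ->
  Ck k W f -> Ck k W (fun x => (f x)^-1).
Proof.
move=> oW f0; elim: k => [|k IH] Ckf.
  by split=> // x Wx; apply: continuousV; [exact: f0|exact: Ck_cont Ckf Wx].
split; first by move=> x Wx; apply: continuousV; [exact: f0|exact: Ck_cont Ckf Wx].
have If := IH (Ck_le Ckf); move: Ckf => [_ df] i; have {df} [df Cf] := df i.
split; first by move=> x Wx; apply: derivableV; [exact: f0|exact: df].
apply: Ck_loc => x Wx; exists W, (fun y =>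
  (-1 * ((f y)^-1 * (f y)^-1)) * 'D_(delta_mx 0 i) f y); split => //.
- apply: (Ck_mul oW _ Cf); apply: (Ck_mul oW (Ck_cst _ _ _)).
  exact: (Ck_mul oW If If).
- move=> y Wy; rewrite deriveV; [|exact: f0|exact: df].
  by rewrite /GRing.scale /= mulN1r -expr2 exprVn.
Qed.

End CkMore.

(** * Smooth functions on the manifold and bump functions *)

Section SmoothOnMore.
Variables (R : realType) (n : nat) (M : smooth_manifold R n).
Implicit Types (U V : set M) (f g : M -> R).

Lemma smooth_on_ext U f g : open U -> (forall p, U p -> f p = g p) ->
  smooth_on U g -> smooth_on U f.
Proof. by move=> oU fg sg; apply: smooth_on_loc => p Up; exists U, g. Qed.

Lemma smooth_on_flat U f m : open U -> smooth_on U f ->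
  smooth_on U (flat m \o f).
Proof.
move=> oU sf c ac k.
by apply: Ck_flat (sf c ac k); exact: chart_open_image.
Qed.

Lemma smooth_on_inv U f : open U -> (forall p, U p -> f p != 0) ->
  smooth_on U f -> smooth_on U (fun p => (f p)^-1).
Proof.
move=> oU f0 sf c ac k; apply: Ck_inv (sf c ac k); first exact: chart_open_image.
by move=> y [p [cp Up] <-]; rewrite chart_mapK//; exact: f0.
Qed.

Lemma smooth_on_chart (c : chart R n M) (j : 'I_n) : mf_atlas c ->
  smooth_on (chart_dom c) (fun p => c p 0 j).
Proof.
move=> ac c' ac' k; apply: Ck_sub (mf_compat ac' ac j k).
by move=> y.
Qed.

(* The bump is exp(-1/(e^2 - |c - c(p)|^2)) in a chart c, extended by zero; its
   support is a compact, hence closed, ball in the chart. *)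
Lemma exists_bump (p : M) U : open U -> U p ->
  exists psi : M -> R, [/\ smooth_on setT psi, psi p != 0 &
    exists V, [/\ open V, (forall q, V q -> psi q = 0) & ~` V `<=` U]].
Proof.
move=> oU Up; have [c ac cp] := mf_cover p.
have oI := @chart_open_image _ _ _ c _ oU.
have : nbhs (c p) (c @` (chart_dom c `&` U)).
  by apply: open_nbhs_nbhs; split=> //; exists p.
move=> /nbhs_ballP [e0 /= e0gt BU].
(* Half the radius, so that the closed cube [B] stays inside the open ball of radius [e0], which is
   a cube for the norm of row vectors. [B] contains the Euclidean ball on which the bump is
   nonzero. *)
pose e := e0 / 2; have egt : 0 < e by rewrite divr_gt0.
pose B := [set y : 'rV[R]_n | forall i, `[c p 0 i - e, c p 0 i + e]%classic (y 0 i)].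
have BsubU : B `<=` c @` (chart_dom c `&` U).
  move=> y By; apply: BU; split => // i j.
  rewrite (ord1 i) /ball /=; have := By j; rewrite /= in_itv /= => /andP[y1 y2].
  by rewrite ltr_norml; apply/andP; split; rewrite /e in y1 y2 egt *; lra.
have cB : compact B.
  apply: (@rV_compact R n (fun i => `[c p 0 i - e, c p 0 i + e]%classic)) => i.
  exact: segment_compact.
pose K := chart_inv c @` B.
have cK : closed K.
  apply: compact_closed; first exact: mf_hausdorff.
  apply: continuous_compact cB; apply: continuous_in_subspaceT => y.
  rewrite inE => /BsubU [q [cq Uq] <-]; apply: chart_inv_cont; by exists q.
have KU : K `<=` chart_dom c `&` U.
  by move=> _ [y /BsubU [q [cq Uq] <-] <-]; rewrite chart_mapK.
pose f q : R := e * e + \sum_(j < n) -1 * ((c q 0 j + - c p 0 j) * (c q 0 j + - c p 0 j)).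
have sf : smooth_on (chart_dom c) f.
  have oc := chart_dom_open c.
  apply: (smooth_on_add oc (smooth_on_cst _ _)); apply: (smooth_on_sum _ oc) => j.
  apply: (smooth_on_mul oc (smooth_on_cst _ _)).
  have sj := smooth_on_add oc (smooth_on_chart j ac) (smooth_on_cst _ (- c p 0 j)).
  exact: (smooth_on_mul oc sj sj).
have f0 q : chart_dom c q -> ~ K q -> f q <= 0.
  move=> cq nKq; rewrite leNgt; apply/negP => fq; apply: nKq.
  exists (c q); last by rewrite chart_mapK.
  move=> i /=; rewrite in_itv /=.
  have : (c q 0 i - c p 0 i) ^+ 2 < e ^+ 2.
    move: fq; rewrite /f (bigD1 i)//= => fq.
    have : \sum_(j < n | j != i) -1 * ((c q 0 j + - c p 0 j) * (c q 0 j + - c p 0 j)) <= 0.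
      by apply: sumr_le0 => j _; rewrite mulN1r oppr_le0 -expr2 sqr_ge0.
    by rewrite !expr2; lra.
  rewrite -[X in X < _]real_normK ?num_real// ltr_pXn2r ?nnegrE ?(ltW egt)//.
  rewrite ltr_norml => /andP[h1 h2].
  by apply/andP; split; lra.
pose psi q := if `[< chart_dom c q >] then flat 0 (f q) else 0.
have psiK q : ~ K q -> psi q = 0.
  move=> nK; rewrite /psi; case: asboolP => // cq; rewrite flat_le0//; exact: f0.
exists psi; split.
- apply: smooth_on_loc => q _.
  have [Kq|nKq] := pselect (K q).
    exists (chart_dom c), (flat 0 \o f); split.
    + exact: chart_dom_open.
    + by have [] := KU _ Kq.
    + by apply: smooth_on_flat => //; exact: chart_dom_open.
    + by move=> x cx; rewrite /psi asboolT.
  exists (~` K), (fun=> 0); split => //; first exact: closed_openC.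
  exact: smooth_on_cst.
- rewrite /psi asboolT// gt_eqF// flat_gt0 /f big1 ?addr0 ?mulr_gt0// => j _.
  by rewrite subrr !mulr0.
- exists (~` K); split => //; first exact: closed_openC.
  by rewrite setCK => q /KU [].
Qed.

End SmoothOnMore.

Section SmoothOnContinuous.
Variables (R : realType) (n : nat) (M : smooth_manifold R n).

Lemma smooth_on_continuous (U : set M) (f : M -> R) p :
  open U -> U p -> smooth_on U f -> {for p, continuous f}.
Proof.
move=> oU Up sf; have [c ac cp] := mf_cover p.
have h : {for c p, continuous (fun y => f (chart_inv c y))}.
  by apply: Ck_cont (sf c ac 0) _; exists p.
have h2 := continuous_comp (chart_map_cont cp) h.
rewrite /prop_for /continuous_at.
have : \forall q \near p, (((fun y => f (chart_inv c y)) \o c) q) = f q.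
  have := open_nbhs_nbhs (conj (chart_dom_open c) cp).
  by apply: filterS => q cq /=; rewrite chart_mapK.
move=> /near_eq_cvg e; apply: cvg_trans e _.
have -> : f p = f (chart_inv c (c p)) by rewrite chart_mapK.
exact: h2.
Qed.

Lemma smooth_on_opp (U : set M) (f : M -> R) :
  open U -> smooth_on U f -> smooth_on U (fun p => - f p).
Proof.
move=> oU sf; apply: (smooth_on_ext oU) (smooth_on_mul oU (smooth_on_cst U (-1)) sf).
by move=> p _ /=; rewrite mulN1r.
Qed.

Lemma smooth_on_sub_fun (U : set M) (f g : M -> R) :
  open U -> smooth_on U f -> smooth_on U g -> smooth_on U (fun p => f p - g p).
Proof. by move=> oU sf sg; apply: (smooth_on_add oU sf); exact: smooth_on_opp. Qed.

End SmoothOnContinuous.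

(** * Global sections from local frames *)

Section ExtendSections.
Variables (R : realType) (n : nat) (M : smooth_manifold R n) (r : nat).
Variable E : vbundle M r.

(** The frame is multiplied by a bump [psi] and extended by zero. This is smooth because [psi]
    vanishes on an open set containing every point outside [frame_dom t]. On [W], where [psi] is
    nonzero, the frame is recovered by division. *)
Lemma frame_section (t : local_frame E r) (p : M) :
  @vb_atlas _ _ _ _ E t -> frame_dom t p ->
  exists (psi : M -> R) (W : set M) (s : 'I_r -> section E),
    [/\ open W, W p, W `<=` frame_dom t, smooth_on W psi &
     forall q, W q -> psi q != 0 /\ forall j : 'I_r, s j q = psi q *: (t q)`_j].
Proof.
move=> at_ tp.
have [psi [spsi psip [V [oV V0 VU]]]] := exists_bump (frame_open t) tp.
pose s (j : 'I_r) q : E q := if `[< frame_dom t q >] then psi q *: (t q)`_j else 0.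
have ss j : smooth_section_on setT (s j).
  move=> t' at' i; apply: smooth_on_loc => q [_ t'q].
  have [tq|ntq] := pselect (frame_dom t q).
    exists (frame_dom t' `&` frame_dom t),
      (fun q => psi q * coord (t' q) i (t q)`_j).
    have oU : open (frame_dom t' `&` frame_dom t) by apply: openI; exact: frame_open.
    split => //.
      apply: (smooth_on_mul oU); first exact: smooth_on_sub spsi.
      exact: vb_compat.
    by move=> x [t'x tx]; rewrite /s asboolT// linearZ.
  exists V, (fun=> 0); split => //.
  - by apply: contrapT => nV; apply: ntq; exact: VU.
  - exact: smooth_on_cst.
  - move=> x Vx; rewrite /s; case: asboolP => tx; last by rewrite linear0.
    by rewrite V0// scale0r linear0.
have cpsi x : {for x, continuous psi}.
  exact: (smooth_on_continuous openT I spsi).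
exists psi, (frame_dom t `&` [set q | psi q != 0]), (fun j => Section (ss j)).
split => //.
- apply: openI; first exact: frame_open.
  apply: (@open_comp _ _ psi [set x | x != 0]); first by move=> x _; exact: cpsi.
  have -> : [set x : R | x != 0] = ~` [set 0] by apply/seteqP; split => x /= /eqP.
  by apply: closed_openC; exact: closed_eq.
- exact: smooth_on_sub spsi.
- by move=> q [tq pq]; split => // j; rewrite /= /s asboolT.
Qed.

Lemma section_through (p : M) (x : E p) : exists s : section E, s p = x.
Proof.
have [t at_ tp] := vb_cover E p.
have [psi [W [s [_ Wp _ _ /(_ p Wp) [p0 sE]]]]] := frame_section at_ tp.
(* Dividing the coordinates of [x] by [psi p] undoes the scaling of the frame at [p]. *)
exists (\sum_(j < r) const_fun M ((psi p)^-1 * coord (t p) j x) *: s j).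
transitivity (\sum_(j < r) (const_fun M ((psi p)^-1 * coord (t p) j x) *: s j) p).
  by elim/big_rec2: _ => //= j _ y _ <-.
rewrite {2}(coord_basis (frame_basis tp) (memvf x)); apply: eq_bigr => j _ /=.
by rewrite sE scalerA mulrAC mulVf// mul1r.
Qed.

End ExtendSections.

(** * Trilinear forms and the eigenspaces of F *)

Section TrilinearForms.
Variables (R : realType) (V : lmodType R) (T : V -> V -> V -> R).

Definition trilinear_form : Prop := forall (a : R) (x x' y z : V),
  [/\ T (a *: x + x') y z = a * T x y z + T x' y z,
      T y (a *: x + x') z = a * T y x z + T y x' z &
      T y z (a *: x + x') = a * T y z x + T y z x'].

Hypothesis T3 : trilinear_form.

Lemma tri0 x y : [/\ T 0 x y = 0, T x 0 y = 0 & T x y 0 = 0].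
Proof.
have [h1 h2 h3] := T3 1 0 0 x y; rewrite scaler0 addr0 !mul1r in h1 h2 h3.
by have [_ _] := T3 1 0 0 y x; rewrite scaler0 addr0 !mul1r => h3'; split; lra.
Qed.

Lemma tri0l x y : T 0 x y = 0. Proof. by have [] := tri0 x y. Qed.
Lemma tri0m x y : T x 0 y = 0. Proof. by have [] := tri0 x y. Qed.
Lemma tri0r x y : T x y 0 = 0. Proof. by have [] := tri0 x y. Qed.

Lemma triD x x' y z : [/\ T (x + x') y z = T x y z + T x' y z,
  T y (x + x') z = T y x z + T y x' z & T y z (x + x') = T y z x + T y z x'].
Proof.
by have [] := T3 1 x x' y z; rewrite scale1r !mul1r.
Qed.

Lemma triZ a x y z : [/\ T (a *: x) y z = a * T x y z,
  T y (a *: x) z = a * T y x z & T y z (a *: x) = a * T y z x].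
Proof.
have [] := T3 a x 0 y z; rewrite !addr0.
by have [-> _ _] := tri0 y z; have [_ -> _] := tri0 y z; have [_ _ ->] := tri0 y z;
  rewrite !addr0.
Qed.

Lemma triN x y z : [/\ T (- x) y z = - T x y z,
  T y (- x) z = - T y x z & T y z (- x) = - T y z x].
Proof. by have [] := triZ (-1) x y z; rewrite !scaleN1r !mulN1r. Qed.

Lemma triDl x x' y z : T (x + x') y z = T x y z + T x' y z.
Proof. by have [] := triD x x' y z. Qed.
Lemma triDm x x' y z : T y (x + x') z = T y x z + T y x' z.
Proof. by have [] := triD x x' y z. Qed.
Lemma triDr x x' y z : T y z (x + x') = T y z x + T y z x'.
Proof. by have [] := triD x x' y z. Qed.
Lemma triZl a x y z : T (a *: x) y z = a * T x y z.
Proof. by have [] := triZ a x y z. Qed.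
Lemma triZm a x y z : T y (a *: x) z = a * T y x z.
Proof. by have [] := triZ a x y z. Qed.
Lemma triZr a x y z : T y z (a *: x) = a * T y z x.
Proof. by have [] := triZ a x y z. Qed.
Lemma triNl x y z : T (- x) y z = - T x y z.
Proof. by have [] := triN x y z. Qed.
Lemma triNm x y z : T y (- x) z = - T y x z.
Proof. by have [] := triN x y z. Qed.
Lemma triNr x y z : T y z (- x) = - T y z x.
Proof. by have [] := triN x y z. Qed.

Definition triE :=
  (triDl, triDm, triDr, triZl, triZm, triZr, triNl, triNm, triNr).

(** The complex-trilinear extension of [T], expanded into real and imaginary parts. *)
Definition cplx_tri (x y z : cplx V) : R[i] :=
  ((T x.1 y.1 z.1 - T x.1 y.2 z.2 - T x.2 y.1 z.2 - T x.2 y.2 z.1) +i*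
  (T x.2 y.1 z.1 + T x.1 y.2 z.1 + T x.1 y.1 z.2 - T x.2 y.2 z.2))%C.

Lemma cplx_tri_linear (a : R[i]) (x x' y z : cplx V) :
  [/\ cplx_tri (a *: x + x') y z = a * cplx_tri x y z + cplx_tri x' y z,
      cplx_tri y (a *: x + x') z = a * cplx_tri y x z + cplx_tri y x' z &
      cplx_tri y z (a *: x + x') = a * cplx_tri y z x + cplx_tri y z x'].
Proof.
case: a => a b; split; apply/eqP; rewrite eq_complex /= !triE; apply/andP;
  split; apply/eqP; ring.
Qed.

Lemma cplx_tri_skew : (forall x y z, T x y z = - T x z y) ->
  forall x y z, cplx_tri x y z = - cplx_tri x z y.
Proof.
move=> sk x y z; apply/eqP; rewrite eq_complex /=.
rewrite (sk x.1 y.1 z.1) (sk x.1 y.2 z.2) (sk x.2 y.1 z.2) (sk x.2 y.2 z.1).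
rewrite (sk x.2 y.1 z.1) (sk x.1 y.2 z.1) (sk x.1 y.1 z.2) (sk x.2 y.2 z.2).
by apply/andP; split; apply/eqP; ring.
Qed.

Lemma cplx_tri_cyclic : (forall x y z, T x y z + T y z x + T z x y = 0) ->
  forall x y z, cplx_tri x y z + cplx_tri y z x + cplx_tri z x y = 0.
Proof.
move=> cyc [x1 x2] [y1 y2] [z1 z2]; apply/eqP; rewrite eq_complex /=.
have h1 := cyc x1 y1 z1; have h2 := cyc x1 y2 z2.
have h3 := cyc x2 y1 z2; have h4 := cyc x2 y2 z1.
have h5 := cyc x2 y1 z1; have h6 := cyc x1 y2 z1.
have h7 := cyc x1 y1 z2; have h8 := cyc x2 y2 z2.
by apply/andP; split; apply/eqP; lra.
Qed.

End TrilinearForms.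

(** * Projections onto the eigenspaces of F *)

Section EigenProjections.
Variables (R : realType) (V : vectType R) (F : 'End(V)).

Definition cplx_end := cplx_map F.

Lemma cplx_end_linear (a : R[i]) (x y : cplx V) :
  cplx_end (a *: x + y) = a *: cplx_end x + cplx_end y.
Proof.
case: a x y => a b [x1 x2] [y1 y2]; rewrite /cplx_end /cplx_map /=.
by congr pair => /=; rewrite !linearD ?linearN !linearZ.
Qed.

Lemma cplx_endZ a x : cplx_end (a *: x) = a *: cplx_end x.
Proof.
have := cplx_end_linear a x 0; rewrite !addr0 => ->.
by rewrite [X in _ + X](_ : _ = 0) ?addr0// /cplx_end /cplx_map /= linear0.
Qed.

Lemma cplx_endD x y : cplx_end (x + y) = cplx_end x + cplx_end y.
Proof. by have := cplx_end_linear 1 x y; rewrite !scale1r. Qed.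

Lemma cplx_endN x : cplx_end (- x) = - cplx_end x.
Proof. by have := cplx_endZ (-1) x; rewrite !scaleN1r. Qed.

(* For e = i, -i, the projection of the complexification onto the
   e-eigenspace along the other eigenspaces, when F^3 = - F. *)
Definition eigen_proj (e : R[i]) (z : cplx V) : cplx V :=
  (2^-1)%:C%C *: (- cplx_end (cplx_end z) - e *: cplx_end z).

Lemma eigen_proj_linear e a x y :
  eigen_proj e (a *: x + y) = a *: eigen_proj e x + eigen_proj e y.
Proof.
rewrite /eigen_proj !cplx_end_linear [a *: (_ *: _)]scalerA [a * _]mulrC -scalerA.
rewrite -scalerDr; congr (_ *: _).
by rewrite [e *: (_ + _)]scalerDr scalerBr scalerN !opprD !scalerA [e * a]mulrC addrACA.
Qed.

(** On the [-e]-eigenspace [- F^2 z = z] and [- e F z = e^2 z = - z], so the two terms cancel. *)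
Lemma eigen_proj_eq0 e z : e * e = -1 -> cplx_end z = - e *: z -> eigen_proj e z = 0.
Proof.
move=> ee Fz; rewrite /eigen_proj Fz cplx_endZ Fz !scalerA mulrNN mulrN ee.
by rewrite scaleN1r !opprK scale1r subrr scaler0.
Qed.

Lemma eigen_proj_ker e z : cplx_end z = 0 -> eigen_proj e z = 0.
Proof.
move=> Fz; have F0 : cplx_end 0 = 0 by rewrite -(scale0r z) cplx_endZ !scale0r.
by rewrite /eigen_proj Fz F0 scaler0 subr0 oppr0 scaler0.
Qed.

Hypothesis F3 : forall x, F (F (F x)) = - F x.

(** By [F^3 = - F], applying [F] to [- F^2 - e F] gives [F - e F^2], which is [e (- F^2 - e F)]
    because [e^2 = -1]. *)
Lemma eigen_projP e z : e * e = -1 -> cplx_end (eigen_proj e z) = e *: eigen_proj e z.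
Proof.
move=> ee; rewrite /eigen_proj cplx_endZ cplx_endD !cplx_endN cplx_endZ.
have -> : cplx_end (cplx_end (cplx_end z)) = - cplx_end z.
  by rewrite /cplx_end /cplx_map /= !F3.
rewrite opprK scalerA mulrC -scalerA; congr (_ *: _).
by rewrite scalerDr !scalerN scalerA ee scaleN1r opprK addrC.
Qed.

End EigenProjections.

(** * The form eta of a tensor on one fibre *)

Section EtaForm.
Variables (R : realType) (V : vectType R) (F : 'End(V)).
Variable T : V -> V -> V -> R.
Hypothesis T3 : trilinear_form T.
Hypothesis Tskew : forall x y z, T x y z = - T x z y.
Hypothesis Tcyc : forall x y z, T x y z + T y z x + T z x y = 0.
Hypothesis TF : forall x y z, T x (F y) z = - T x y (F z).
Hypothesis F3 : forall x, F (F (F x)) = - F x.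
Hypothesis Tker : forall x y z, T x (- F (F y)) z = T x y z.

(** The factor 2 arises because [T] is the skew-symmetrization of its component on L, L, Lbar plus
    the complex conjugate, hence twice a real part. *)
Definition eta_form (x y z : cplx V) : R[i] :=
  2%:C%C * cplx_tri T (eigen_proj F 'i%C x) (eigen_proj F 'i%C y)
                      (eigen_proj F (- 'i%C) z).

Lemma mul_ii : 'i%C * 'i%C = -1 :> R[i].
Proof. by rewrite -expr2 sqr_i. Qed.

Lemma eta_form_sym x y z : eta_form x y z = eta_form y x z.
Proof.
rewrite /eta_form; congr (_ * _).
set px := eigen_proj _ _ x; set py := eigen_proj _ _ y; set qz := eigen_proj _ _ z.
have Fx : cplx_end F px = 'i%C *: px by apply: eigen_projP => //; exact: mul_ii.
have Fy : cplx_end F py = 'i%C *: py by apply: eigen_projP => //; exact: mul_ii.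
clearbody px py qz.
have TFc u v w : cplx_tri T u (cplx_end F v) w = - cplx_tri T u v (cplx_end F w).
  by apply/eqP; rewrite eq_complex /= !TF; apply/andP; split; apply/eqP; ring.
have Zm a u v w : cplx_tri T u (a *: v) w = a * cplx_tri T u v w.
  have [_ + _] := cplx_tri_linear T3 a v 0 u w; rewrite addr0 => ->.
  have [_ + _] := cplx_tri_linear T3 (-1) 0 0 u w.
  by rewrite scaler0 addr0 mulN1r addNr => ->; rewrite addr0.
(* Both last arguments are [i]-eigenvectors, so moving [F] from one to the other equates [i] times
   the value with [- i] times it. *)
have q0 : cplx_tri T qz px py = 0.
  have h := TFc qz px py; rewrite Fx Fy Zm in h.
  move: h; rewrite [cplx_tri T qz px ('i%C *: py)]cplx_tri_skew// Zm.
  rewrite [cplx_tri T qz py px]cplx_tri_skew// mulrN opprK => h.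
  have : 'i%C * cplx_tri T qz px py + 'i%C * cplx_tri T qz px py = 0.
    by rewrite {1}h addNr.
  move/eqP; rewrite -mulr2n mulrn_eq0 /= mulf_eq0 => /orP[|/eqP//].
  by rewrite eq_complex /= oner_eq0 andbF.
(* With one of its three terms zero, the cyclic identity becomes, by skewness, the symmetry in the
   first two arguments. *)
have := cplx_tri_cyclic Tcyc px py qz; rewrite q0 addr0.
rewrite [cplx_tri T py qz px]cplx_tri_skew// => /eqP.
by rewrite subr_eq0 => /eqP.
Qed.

Lemma eta_form_linear (a : R[i]) (x x' y z : cplx V) :
  [/\ eta_form (a *: x + x') y z = a * eta_form x y z + eta_form x' y z,
      eta_form y (a *: x + x') z = a * eta_form y x z + eta_form y x' z &
      eta_form y z (a *: x + x') = a * eta_form y z x + eta_form y z x'].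
Proof.
rewrite /eta_form !eigen_proj_linear.
by split;
  [have [-> _ _] := cplx_tri_linear T3 a (eigen_proj F 'i%C x)
     (eigen_proj F 'i%C x') (eigen_proj F 'i%C y) (eigen_proj F (-'i%C) z)
  |have [_ -> _] := cplx_tri_linear T3 a (eigen_proj F 'i%C x)
     (eigen_proj F 'i%C x') (eigen_proj F 'i%C y) (eigen_proj F (-'i%C) z)
  |have [_ _ ->] := cplx_tri_linear T3 a (eigen_proj F (-'i%C) x)
     (eigen_proj F (-'i%C) x') (eigen_proj F 'i%C y) (eigen_proj F 'i%C z)];
  rewrite mulrDr mulrCA.
Qed.

Lemma eigen_proj_inj (u : V) :
  eigen_proj F 'i%C (cplx_inj u) = (2^-1 *: - F (F u), 2^-1 *: - F u) :> cplx V.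
Proof.
rewrite /eigen_proj /cplx_end /cplx_map /cplx_inj /= !linear0; congr pair => /=.
  by rewrite /cplx_scale /= !(scale0r, scaler0, subr0, addr0).
by rewrite /cplx_scale /= !(scale0r, scaler0, subr0, addr0, scale1r, add0r, oppr0).
Qed.

Lemma eigen_proj_inj_conj (u : V) :
  eigen_proj F (- 'i%C) (cplx_inj u) = (2^-1 *: - F (F u), 2^-1 *: F u) :> cplx V.
Proof.
rewrite /eigen_proj /cplx_end /cplx_map /cplx_inj /= !linear0; congr pair => /=.
  by rewrite /cplx_scale /= !(oppr0, scale0r, scaler0, subr0, addr0).
by rewrite /cplx_scale /= !(scale0r, scaler0, subr0, addr0, scaleN1r, opprK, add0r, oppr0).
Qed.

(** On real vectors the real part of [eta_form] is [(T u v w - T (F u) (F v) w) / 2]. The second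
    term is symmetric in [v], [w], so it drops out of the difference, while the first is skew and
    doubles. *)
Lemma Re_sk_eta_form u v w :
  complex.Re (eta_form (cplx_inj u) (cplx_inj v) (cplx_inj w) -
              eta_form (cplx_inj u) (cplx_inj w) (cplx_inj v)) = T u v w.
Proof.
have Tr x y z : T x y (- F (F z)) = T x y z by rewrite Tskew Tker -Tskew.
(* The cyclic identity carries the invariance under [- F^2] from the last two slots to the first. *)
have Tl x y z : T (- F (F x)) y z = T x y z.
  have := Tcyc (- F (F x)) y z; have := Tcyc x y z; rewrite Tr Tker; lra.
rewrite /eta_form !eigen_proj_inj !eigen_proj_inj_conj /=.
rewrite !(triZl T3, triZm T3, triZr T3) !Tl !Tker !Tr !triNl// !triNm//.
have h1 x y z : T x (F y) (F z) = T x y z.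
  by rewrite TF -triNr// Tr.
rewrite !h1 (TF (F u) v w) (TF (F u) w v).
rewrite (Tskew u w v) (Tskew (F u) w (F v)).
rewrite (TF (F u) v w); lra.
Qed.

End EtaForm.

Section AlmostComplexFibre.
Variables (R : realType) (V : vectType R) (F : 'End(V)).
Variables (u0 : V) (l : V -> R).
Hypothesis Fu0 : F u0 = 0.
Hypothesis FF : forall x, F (F x) = - x + l x *: u0.

Lemma almost_complex_cube x : F (F (F x)) = - F x.
Proof. by rewrite [F (F x)]FF linearD linearN linearZ /= Fu0 scaler0 addr0. Qed.

(** Since [- F^2] differs from the identity by multiples of [u0], it suffices that [T x u0 w = 0].
    For [w = u0] this is skewness; for [w] in the image of [F], moving [F] onto [u0] gives 0; and
    every [w] is a sum of two such vectors. *)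
Lemma tri_kills_kernel (T : V -> V -> V -> R) : trilinear_form T ->
  (forall x y z, T x y z = - T x z y) ->
  (forall x y z, T x (F y) z = - T x y (F z)) ->
  forall x y z, T x (- F (F y)) z = T x y z.
Proof.
move=> T3 Tskew TF x y z.
have uu : T x u0 u0 = 0 by have := Tskew x u0 u0; lra.
have uz w : T x u0 w = 0.
  have -> : w = - F (F w) + l w *: u0 by rewrite FF opprD opprK addrNK.
  rewrite !(triDr T3, triNr T3, triZr T3) uu mulr0 addr0.
  have := TF x u0 (F w); rewrite Fu0; have [_ -> _] := tri0 T3 x (F w).
  by move=> <-.
by rewrite FF opprD opprK -scaleNr (triDm T3) (triZm T3) uz mulr0 addr0.
Qed.

End AlmostComplexFibre.

(** * Smoothness of tensors and of eta *)

Section Tensors.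
Variables (R : realType) (n : nat) (M : smooth_manifold R n) (r : nat).
Variable E : vbundle M r.
Variable T : forall p, E p -> E p -> E p -> R.

Definition smooth_tensor : Prop := forall u v w : section E,
  smooth_on setT (fun p => T (u p) (v p) (w p)).

(** Frame vectors need not extend to global sections, so [T] is evaluated on their cut-offs and the
    three factors [psi] are divided out near [p]. *)
Lemma smooth_tensor_frame : (forall p, trilinear_form (@T p)) -> smooth_tensor ->
  forall t, @vb_atlas _ _ _ _ E t -> forall i j k : 'I_r,
  smooth_on (frame_dom t) (fun p => T (t p)`_i (t p)`_j (t p)`_k).
Proof.
move=> T3 sT t at_ i j k; apply: smooth_on_loc => p tp.
have [psi [W [s [oW Wp Wt spsi sE]]]] := frame_section at_ tp.
exists W, (fun q => (psi q)^-1 * ((psi q)^-1 * ((psi q)^-1 *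
  T (s i q) (s j q) (s k q)))); split => //.
  have si : smooth_on W (fun q => (psi q)^-1).
    by apply: smooth_on_inv => // q /sE [].
  do 3! apply: (smooth_on_mul oW si).
  exact: smooth_on_sub (sT (s i) (s j) (s k)).
move=> q /sE [psi0 sq].
rewrite !sq (triZl (T3 q)) (triZm (T3 q)) (triZr (T3 q)).
by rewrite !mulKf.
Qed.

End Tensors.

Section EtaField.
Variables (R : realType) (n : nat) (M : smooth_manifold R n) (r : nat).
Variable E : courant_algebroid M r.
Variable F : endo_field E.
Variable T : forall p, E p -> E p -> E p -> R.
Hypothesis T3 : forall p, trilinear_form (@T p).
Hypothesis sT : smooth_tensor T.

Definition eta_field : cform3 E := fun p => eta_form (F p) (@T p).

(** The real and imaginary parts are real trilinear forms on [E]. On global sections they are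
    combinations of values of [T], and [smooth_tensor_frame] passes from sections to frames. *)
Lemma eta_field_smooth : csmooth eta_field.
Proof.
(* [PN] is the common real part of the two eigenprojections of a real section; [PF] and [PG] are the
   imaginary parts for [i] and [- i]. *)
pose PN (u : section E) : section E :=
  const_fun M 2^-1 *: - endo_app F (endo_app F u).
pose PF (u : section E) : section E := const_fun M 2^-1 *: - endo_app F u.
pose PG (u : section E) : section E := const_fun M 2^-1 *: endo_app F u.
have oT : open [set: M] by exact: openT.
have L3 := fun p => eta_form_linear (F p) (@T3 p).
have inj3 p (a : R) (x y : E p) :
    cplx_inj (a *: x + y) = (a%:C)%C *: cplx_inj x + cplx_inj y.
  rewrite /cplx_inj; congr pair => /=; rewrite ?scale0r ?scaler0 ?subr0 ?addr0 //.
have Re_axpy (a : R) (x y : R[i]) :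
    complex.Re ((a%:C)%C * x + y) = a * complex.Re x + complex.Re y.
  by case: x y => [x1 x2] [y1 y2] /=; rewrite mul0r subr0.
have Im_axpy (a : R) (x y : R[i]) :
    complex.Im ((a%:C)%C * x + y) = a * complex.Im x + complex.Im y.
  by case: x y => [x1 x2] [y1 y2] /=; rewrite mul0r addr0.
have sd := smooth_on_cst (M := M) setT (2 : R).
move=> t at_ i j k; split.
- apply: (@smooth_tensor_frame _ _ _ _ E (fun p x y z => complex.Re
    (eta_field (cplx_inj x) (cplx_inj y) (cplx_inj z)))) => //.
    move=> p a x x' y z; rewrite /eta_field !inj3.
    have [-> _ _] := L3 p (a%:C)%C (cplx_inj x) (cplx_inj x') (cplx_inj y) (cplx_inj z).
    have [_ -> _] := L3 p (a%:C)%C (cplx_inj x) (cplx_inj x') (cplx_inj y) (cplx_inj z).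
    have [_ _ ->] := L3 p (a%:C)%C (cplx_inj x) (cplx_inj x') (cplx_inj y) (cplx_inj z).
    by split; rewrite Re_axpy.
  move=> u v w.
  apply: (smooth_on_ext oT (g := fun p => 2 * (T (PN u p) (PN v p) (PN w p)
    - T (PN u p) (PF v p) (PG w p) - T (PF u p) (PN v p) (PG w p)
    - T (PF u p) (PF v p) (PN w p)))).
    move=> p _; rewrite /eta_field /eta_form !eigen_proj_inj eigen_proj_inj_conj.
    by rewrite /= mul0r subr0.
  apply: (smooth_on_mul oT sd).
  by do 3! (apply: (smooth_on_sub_fun oT); last exact: sT); exact: sT.
- apply: (@smooth_tensor_frame _ _ _ _ E (fun p x y z => complex.Im
    (eta_field (cplx_inj x) (cplx_inj y) (cplx_inj z)))) => //.
    move=> p a x x' y z; rewrite /eta_field !inj3.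
    have [-> _ _] := L3 p (a%:C)%C (cplx_inj x) (cplx_inj x') (cplx_inj y) (cplx_inj z).
    have [_ -> _] := L3 p (a%:C)%C (cplx_inj x) (cplx_inj x') (cplx_inj y) (cplx_inj z).
    have [_ _ ->] := L3 p (a%:C)%C (cplx_inj x) (cplx_inj x') (cplx_inj y) (cplx_inj z).
    by split; rewrite Im_axpy.
  move=> u v w.
  apply: (smooth_on_ext oT (g := fun p => 2 * (T (PF u p) (PN v p) (PN w p)
    + T (PN u p) (PF v p) (PN w p) + T (PN u p) (PN v p) (PG w p)
    - T (PF u p) (PF v p) (PG w p)))).
    move=> p _; rewrite /eta_field /eta_form !eigen_proj_inj eigen_proj_inj_conj.
    by rewrite /= mul0r addr0.
  apply: (smooth_on_mul oT sd).
  apply: (smooth_on_sub_fun oT); last exact: sT.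
  by do 2! (apply: (smooth_on_add oT); last exact: sT); exact: sT.
Qed.

End EtaField.

(** * The difference of two generalized connections *)

Section ConnectionAtPoint.
Variables (R : realType) (n : nat) (M : smooth_manifold R n) (r : nat).
Variables (E : courant_algebroid M r) (D : gen_connection E).

Lemma torsion_free_at (u v w : section E) p : torsion_free D ->
  ca_sp E p (D v p (u p)) (w p) - ca_sp E p (D u p (v p)) (w p)
  - ca_sp E p (@ca_bracket _ _ _ _ E u v p) (w p)
  + ca_sp E p (D u p (w p)) (v p) = 0.
Proof.
move=> tD; rewrite -!linearBl.
by have := congr1 (fun f : smooth_fun M => f p) (tD u v w).
Qed.

Lemma preserves_metric_at (G : gen_metric E) (u v w : section E) p :
  preserves_metric D G ->
  anchor_act (ca_anchor E) w (metric_form G u v) p =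
    ca_sp E p (gm_end G p (D u p (w p))) (v p) +
    ca_sp E p (gm_end G p (u p)) (D v p (w p)).
Proof.
move=> pD; apply: subr0_eq; rewrite opprD addrA.
by have := congr1 (fun f : smooth_fun M => f p) (pD w u v).
Qed.

End ConnectionAtPoint.

Section DifferenceTensor.
Variables (R : realType) (n : nat) (M : smooth_manifold R n) (r : nat).
Variables (E : courant_algebroid M r) (D D' : gen_connection E).

Definition section_at (p : M) (x : E p) : section E :=
  projT1 (cid (section_through x)).

Lemma section_atE p (x : E p) : section_at x p = x.
Proof. exact: projT2 (cid (section_through x)). Qed.

Definition conn_diff (v : section E) (p : M) (x : E p) : E p :=
  D' v p x - D v p x.

(** The anchor term in the metric condition is the same for [D] and [D'], so it cancels in the
    difference. *)
Lemma conn_diff_skew (u v w : section E) p :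
  ca_sp E p (conn_diff v (u p)) (w p) = - ca_sp E p (conn_diff w (u p)) (v p).
Proof.
have h := congr1 (fun f : smooth_fun M => f p) (gc_metric D v w u).
have h' := congr1 (fun f : smooth_fun M => f p) (gc_metric D' v w u).
rewrite /= in h h'; rewrite h in h'.
rewrite /conn_diff !linearBl /=.
rewrite (sp_sym _ (D' w p (u p))) (sp_sym _ (D w p (u p))).
move: h'; rewrite -[LHS]/(_ + _) -[RHS]/(_ + _). lra.
Qed.

(** Subtracting the two torsions cancels the bracket; skewness brings the three remaining terms into
    cyclic form. *)
Lemma conn_diff_cyclic : torsion_free D -> torsion_free D' -> forall (u v w : section E) p,
  ca_sp E p (conn_diff v (u p)) (w p) + ca_sp E p (conn_diff w (v p)) (u p) +
  ca_sp E p (conn_diff u (w p)) (v p) = 0.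
Proof.
move=> tD tD' u v w p.
have h := torsion_free_at u v w p tD; have h' := torsion_free_at u v w p tD'.
by have := conn_diff_skew v u w p; rewrite /conn_diff !linearBl /=; lra.
Qed.

(* The choice of the section through y is irrelevant: by skewness y can be moved
   to the last slot, which only sees its value at p. *)
Definition diff_tensor (p : M) (x y z : E p) : R :=
  ca_sp E p (conn_diff (section_at y) x) z.

Lemma diff_tensorE (u v w : section E) p :
  diff_tensor (u p) (v p) (w p) = ca_sp E p (conn_diff v (u p)) (w p).
Proof.
by rewrite /diff_tensor conn_diff_skew section_atE -conn_diff_skew.
Qed.

Lemma diff_tensor_skew p (x y z : E p) :
  diff_tensor x y z = - diff_tensor x z y.
Proof.
rewrite -(section_atE x) -(section_atE y) -(section_atE z) !diff_tensorE.
exact: conn_diff_skew.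
Qed.

(** Linearity in the middle slot, where a section was chosen, is carried over from the last slot by
    skewness. *)
Lemma diff_tensor_linear p : trilinear_form (@diff_tensor p).
Proof.
have L3 a (x x' y z : E p) :
    diff_tensor y z (a *: x + x') = a * diff_tensor y z x + diff_tensor y z x'.
  by rewrite /diff_tensor linearDr linearZr_LR.
move=> a x x' y z; split => //.
  rewrite /diff_tensor.
  have -> s : conn_diff s (a *: x + x') = a *: conn_diff s x + conn_diff s x'.
    by rewrite /conn_diff !linearD !linearZ addrACA.
  by rewrite linearDl /= linearZl_LR.
by rewrite ![diff_tensor y _ z]diff_tensor_skew L3 opprD mulrN.
Qed.

Lemma diff_tensor_smooth : smooth_tensor diff_tensor.
Proof.
move=> u v w; have := smooth_funP (inner (ca_sp E) (cov D' u v - cov D u v) w).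
by apply: smooth_on_ext; [exact: openT|move=> p _; rewrite diff_tensorE].
Qed.

Lemma diff_tensor_cyclic : torsion_free D -> torsion_free D' ->
  forall p (x y z : E p),
  diff_tensor x y z + diff_tensor y z x + diff_tensor z x y = 0.
Proof.
move=> tD tD' p x y z.
rewrite -(section_atE x) -(section_atE y) -(section_atE z) !diff_tensorE.
exact: conn_diff_cyclic.
Qed.

Lemma diff_tensor_endo (F : endo_field E) :
  (forall p (x y : E p), ca_sp E p (F p x) y = - ca_sp E p x (F p y)) ->
  preserves_endo D F -> preserves_endo D' F ->
  forall p (x y z : E p), diff_tensor x (F p y) z = - diff_tensor x y (F p z).
Proof.
move=> Fskew pD pD' p x y z.
rewrite -(section_atE x) -(section_atE y) -(section_atE z).
move: (section_at x) (section_at y) (section_at z) => u v w.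
rewrite -[F p (v p)]/(endo_app F v p) -[F p (w p)]/(endo_app F w p) !diff_tensorE.
have h := congr1 (fun s : section E => s p) (pD u v).
have h' := congr1 (fun s : section E => s p) (pD' u v).
rewrite /cov_endo /= in h h'.
move/subr0_eq: h => h; move/subr0_eq: h' => h'.
by rewrite /conn_diff h h' -linearB Fskew.
Qed.

(** The argument for [conn_diff_skew], with the form of [G] in place of the scalar product, gives
    [S x y (G z) = - S x z (G y)]; skewness of [S] then concludes. *)
Lemma diff_tensor_metric (G : gen_metric E) :
  (forall p (x y : E p), ca_sp E p (gm_end G p x) y = ca_sp E p x (gm_end G p y)) ->
  preserves_metric D G -> preserves_metric D' G ->
  forall p (x y z : E p),
  diff_tensor x (gm_end G p y) z = diff_tensor x y (gm_end G p z).
Proof.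
move=> Gsym pD pD' p x y z.
rewrite -(section_atE x) -(section_atE y) -(section_atE z).
move: (section_at x) (section_at y) (section_at z) => u v w.
rewrite [LHS]diff_tensor_skew.
rewrite -[gm_end G p (v p)]/(endo_app (gm_end G) v p).
rewrite -[gm_end G p (w p)]/(endo_app (gm_end G) w p) !diff_tensorE.
have := preserves_metric_at v w u p pD'; rewrite (preserves_metric_at v w u p pD).
have e (a b : E p) : ca_sp E p (gm_end G p a) b = ca_sp E p b (gm_end G p a).
  exact: sp_sym.
rewrite /conn_diff !linearBl /= (e (v p)) (e (v p)) !Gsym; lra.
Qed.

Lemma diff_tensor_shifted (S : forall p, E p -> E p -> E p -> R) :
  (forall p x y z, S p x y z = diff_tensor x y z) -> shifted_by D D' S.
Proof.
move=> SE u v w p; rewrite SE diff_tensorE /conn_diff linearBl /=.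
by rewrite addrC subrK.
Qed.

End DifferenceTensor.

(** * Orthogonal complements and the splitting by a generalized metric *)

Section Orthogonal.
Variables (R : realType) (V : vectType R) (B : {biscalar V}) (W : {vspace V}).

(** The orthogonal of [W] is the kernel of the pairing with a basis of [W], so its codimension is at
    most [\dim W]. It meets [W] in 0, and a dimension count shows that the sum is everything. *)
Lemma orthogonal_decomposition :
  (forall x, x \in W -> (forall y, y \in W -> B x y = 0) -> x = 0) ->
  forall x, exists a b, [/\ x = a + b, a \in W & forall y, y \in W -> B b y = 0].
Proof.
move=> nd x; set k := \dim W.
pose f (v : V) : 'rV[R]_k := \row_i B v (vbasis W)`_i.
have f_lin : linear f.
  by move=> a u v; apply/rowP => i; rewrite !mxE linearDl /= linearZl_LR.
pose fL : {linear V -> 'rV[R]_k} := HB.pack f (GRing.isLinear.Build _ _ _ _ f f_lin).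
pose g := linfun fL.
have gker v : v \in lker g -> forall y, y \in W -> B v y = 0.
  rewrite memv_ker lfunE => /eqP /rowP fv y /coord_vbasis ->.
  rewrite linear_sumr big1 // => i _ /=; rewrite linearZr_LR /=.
  by have := fv i; rewrite !mxE => ->; rewrite mulr0.
have WK : (W :&: lker g = 0)%VS.
  apply/eqP; rewrite -subv0; apply/subvP => v; rewrite memv_cap => /andP[vW vK].
  by rewrite memv0; apply/eqP; apply: nd => //; exact: gker.
have full : (W + lker g = fullv)%VS.
  apply/eqP; rewrite eqEdim subvf /= dimv_disjoint_sum//.
  rewrite -(limg_ker_dim g fullv) capfv addnC leq_add2r.
  by rewrite (leq_trans (dimvS (subvf _)))// dimvf /dim /= mul1n.
have := memvf x; rewrite -full => /memv_addP [a aW [b bK ->]].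
by exists a, b; split => //; exact: gker.
Qed.

End Orthogonal.

Section GenMetric.
Variables (R : realType) (n : nat) (M : smooth_manifold R n) (r : nat).
Variables (E : courant_algebroid M r) (G : gen_metric E).

(** [gm_end] is specified only on [E_-] and on its orthogonal; the decomposition reduces to
    these. *)
Lemma gm_end_inv p (x : E p) : gm_end G p (gm_end G p x) = x.
Proof.
have [a [b [-> aW bW]]] := orthogonal_decomposition (@gm_neg_nondeg _ _ _ _ _ G p) x.
by rewrite !linearD /= !(gm_end_pos bW) (gm_end_neg aW) linearN /= (gm_end_neg aW) opprK.
Qed.

Lemma gm_end_sym p (x y : E p) :
  ca_sp E p (gm_end G p x) y = ca_sp E p x (gm_end G p y).
Proof.
have [a [b [-> aW bW]]] := orthogonal_decomposition (@gm_neg_nondeg _ _ _ _ _ G p) x.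
have [c [d [-> cW dW]]] := orthogonal_decomposition (@gm_neg_nondeg _ _ _ _ _ G p) y.
have -> : gm_end G p (a + b) = - a + b.
  by rewrite linearD /= (gm_end_pos bW) (gm_end_neg aW).
have -> : gm_end G p (c + d) = - c + d.
  by rewrite linearD /= (gm_end_pos dW) (gm_end_neg cW).
rewrite !linearDl /= !linearD /= !linearN /= !linearNl (bW _ cW).
by rewrite (sp_sym _ a d) (dW _ aW) oppr0.
Qed.

Definition gm_sign (s : bool) : R := if s then 1 else -1.

(** The projection onto [E_+] ([s = true]) or [E_-] ([s = false]) along the other. *)
Definition gm_proj (s : bool) (p : M) (x : E p) : E p :=
  2^-1 *: (x + gm_sign s *: gm_end G p x).

Lemma gm_proj_linear s p a (x y : E p) :
  gm_proj s (a *: x + y) = a *: gm_proj s x + gm_proj s y.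
Proof.
rewrite /gm_proj [gm_end G p _]linearP [gm_sign s *: (_ + _)]scalerDr.
rewrite [gm_sign s *: (_ *: _)]scalerA.
rewrite [gm_sign s * a]mulrC -scalerA addrACA.
rewrite -[a *: x + _]scalerDr [2^-1 *: (a *: _ + _)]scalerDr.
by rewrite !scalerA [a / 2]mulrC.
Qed.

Lemma gm_proj_part s s' p (x : E p) : gm_part G s' x -> s <> s' -> gm_proj s x = 0.
Proof.
rewrite /gm_proj; case: s s' => [] [] //= xs _; first by rewrite (gm_end_neg xs) scale1r subrr scaler0.
by rewrite (gm_end_pos xs) scaleN1r subrr scaler0.
Qed.

Lemma gm_proj_comm (F : endo_field E) s p (x : E p) :
  gm_end G p (F p x) = F p (gm_end G p x) ->
  gm_proj s (F p x) = F p (gm_proj s x).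
Proof.
move=> GF; rewrite /gm_proj GF.
rewrite [F p (2^-1 *: _)]linearZ /= [F p (x + _)]linearD /=.
by rewrite [F p (_ *: gm_end G p x)]linearZ.
Qed.

Section SplitTensor.
Variable S : forall p, E p -> E p -> E p -> R.

Definition split_tensor (s : bool) (p : M) (x y z : E p) : R :=
  S (gm_proj s x) (gm_proj s y) (gm_proj s z).

Lemma split_tensor_linear s : (forall p, trilinear_form (@S p)) ->
  forall p, trilinear_form (@split_tensor s p).
Proof.
move=> S3 p a x x' y z; rewrite /split_tensor !gm_proj_linear.
by have [] := S3 p a (gm_proj s x) (gm_proj s x') (gm_proj s y) (gm_proj s z).
Qed.

Lemma split_tensor_smooth s : smooth_tensor S -> smooth_tensor (@split_tensor s).
Proof.
move=> sS u v w.
pose P (u : section E) : section E := const_fun M 2^-1 *: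
  (u + const_fun M (gm_sign s) *: endo_app (gm_end G) u).
exact: sS (P u) (P v) (P w).
Qed.

(** Components of [S] whose last two arguments lie in different parts vanish because [G^end] moves
    between these slots; the cyclic identity then kills those whose first argument lies in the other
    part. *)
Lemma split_tensor_sum p (x y z : E p) :
  trilinear_form (@S p) ->
  (forall x y z, @S p x y z = - S x z y) ->
  (forall x y z, @S p x y z + S y z x + S z x y = 0) ->
  (forall x y z, @S p x (gm_end G p y) z = S x y (gm_end G p z)) ->
  split_tensor true x y z + split_tensor false x y z = S x y z.
Proof.
move=> S3 Ssk Scy SG; rewrite /split_tensor /gm_proj /gm_sign !scale1r !scaleN1r.
rewrite !(triE S3).
have SGG a b c : @S p a (gm_end G p b) (gm_end G p c) = S a b c.
  by rewrite SG gm_end_inv.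
have h : S (gm_end G p x) y (gm_end G p z) = S x y z.
  (* The cyclic identity with [G^end] applied to no argument and to each pair of arguments. Only
     three values involving [G^end] remain; their sum is 0, which determines each of them. *)
  have e0 := Scy x y z.
  have e1 := Scy x (gm_end G p y) (gm_end G p z).
  have e2 := Scy (gm_end G p x) y (gm_end G p z).
  have e3 := Scy (gm_end G p x) (gm_end G p y) z.
  move: e0 e1 e2 e3; rewrite !SGG !SG; lra.
rewrite !SGG !SG !h; lra.
Qed.

End SplitTensor.
End GenMetric.

(** * Vanishing of eta on the other summands *)

Lemma cplx_tri0 (R : realType) (V : lmodType R) (T : V -> V -> V -> R) :
  trilinear_form T -> forall x y,
  [/\ cplx_tri T 0 x y = 0, cplx_tri T x 0 y = 0 & cplx_tri T x y 0 = 0].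
Proof.
move=> T3 x y; split; apply/eqP; rewrite eq_complex /=;
  by rewrite ?(tri0l T3) ?(tri0m T3) ?(tri0r T3) !subr0 ?addr0 eqxx.
Qed.

Section AlmostComplexKills.
Variables (R : realType) (n : nat) (M : smooth_manifold R n) (r : nat).
Variables (E : courant_algebroid M r) (F : endo_field E).

(** For [F u0 = 0]: the formula for [F^2] gives [F^2 u0 = 0], and skewness gives [<F u0, u0> = 0].
    Evaluating [F^2] at [F u0] then yields both [0] and [- F u0]. *)
Lemma Bn_almost_complex_fibre : Bn_almost_complex F -> forall p,
  exists (u0 : E p) (l : E p -> R),
    F p u0 = 0 /\ forall x, F p (F p x) = - x + l x *: u0.
Proof.
case=> Fskew _ [u0 [u0u0 FF]] p.
exists (u0 p), (fun x => (-1) ^+ n * ca_sp E p x (u0 p)); split => //.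
have FFu : F p (F p (u0 p)) = 0.
  by rewrite FF u0u0 -exprMn mulrNN mulr1 expr1n scale1r addNr.
have uFu : ca_sp E p (F p (u0 p)) (u0 p) = 0.
  have := Fskew p (u0 p) (u0 p); rewrite (sp_sym _ (u0 p)); lra.
have := FF p (F p (u0 p)); rewrite FFu linear0 uFu mulr0 scale0r addr0.
by move=> /esym /eqP; rewrite oppr_eq0 => /eqP.
Qed.

(** As [F] is real, conjugating the eigenvalue equation gives [F z = - i z]. *)
Lemma eigen_proj_Lbar p z : csub_conj (i_eigen F) z -> eigen_proj (F p) 'i%C z = 0.
Proof.
move=> Fz; apply: eigen_proj_eq0; first exact: mul_ii.
case: z Fz => x y [h1 h2]; rewrite /= in h1 h2; congr pair => /=.
  by rewrite h1 oppr0 !scale0r !sub0r scaleN1r !scale1r opprK.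
move: h2; rewrite linearN scale0r add0r scale1r => /(congr1 -%R).
by rewrite opprK oppr0 scale0r add0r scaleN1r.
Qed.

Lemma eigen_proj_L p z : i_eigen F z -> eigen_proj (F p) (- 'i%C) z = 0.
Proof.
move=> Fz; apply: eigen_proj_eq0; first by rewrite mulrNN mul_ii.
by rewrite opprK.
Qed.

Variables (T : forall p, E p -> E p -> E p -> R).
Hypothesis T3 : forall p, trilinear_form (@T p).

Lemma eta_field_eq0l p x y z :
  eigen_proj (F p) 'i%C x = 0 -> eta_field F T x y z = 0.
Proof.
rewrite /eta_field /eta_form => ->.
by have [-> _ _] := cplx_tri0 (@T3 p) (eigen_proj (F p) 'i%C y)
  (eigen_proj (F p) (- 'i%C) z); rewrite mulr0.
Qed.

Lemma eta_field_eq0r p x y z :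
  eigen_proj (F p) (- 'i%C) z = 0 -> eta_field F T x y z = 0.
Proof.
rewrite /eta_field /eta_form => ->.
by have [_ _ ->] := cplx_tri0 (@T3 p) (eigen_proj (F p) 'i%C x)
  (eigen_proj (F p) 'i%C y); rewrite mulr0.
Qed.

(** The part of the argument common to both statements; only the vanishing on other summands depends
    on the decomposition. *)
Lemma eta_field_S2 (I : Type) (dec : I -> csub E) (a b : I) :
  smooth_tensor T ->
  (forall p x y z, @T p x y z = - T x z y) ->
  (forall p x y z, @T p x y z + T y z x + T z x y = 0) ->
  (forall p x y z, @T p x (F p y) z = - T x y (F p z)) ->
  (forall p x, F p (F p (F p x)) = - F p x) ->
  (forall c, c <> a -> forall p x y z, dec c p x -> eta_field F T x y z = 0) ->
  (forall c, c <> b -> forall p x y z, dec c p z -> eta_field F T x y z = 0) ->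
  S2_section dec a b (eta_field F T).
Proof.
move=> sT Tsk Tcy TF F3 za zb; split => //.
- by move=> p c x x' y z; exact: eta_form_linear.
- exact: eta_field_smooth.
- by move=> p x y z; exact: (eta_form_sym (@T3 p)).
Qed.

End AlmostComplexKills.

Section SplitKills.
Variables (R : realType) (n : nat) (M : smooth_manifold R n) (r : nat).
Variables (E : courant_algebroid M r) (G : gen_metric E) (F : endo_field E).
Hypothesis GF : forall p x, gm_end G p (F p x) = F p (gm_end G p x).
Variable (S : forall p, E p -> E p -> E p -> R).
Hypothesis S3 : forall p, trilinear_form (@S p).

(** [eigen_proj] is a polynomial in [F], which commutes with [G^end]. Hence it preserves the
    complexified kernel [K] of [gm_proj s], which contains the other part. *)
Lemma eigen_proj_part e s s' p (z : cplx (E p)) :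
  gm_part G s' z.1 -> gm_part G s' z.2 -> s <> s' ->
  gm_proj G s (eigen_proj (F p) e z).1 = 0 /\
  gm_proj G s (eigen_proj (F p) e z).2 = 0.
Proof.
move=> z1 z2 ss'.
pose K (w : cplx (E p)) := gm_proj G s w.1 = 0 /\ gm_proj G s w.2 = 0.
have Q0 : gm_proj G s (0 : E p) = 0 by rewrite /gm_proj linear0 scaler0 addr0 scaler0.
have QD (x y : E p) : gm_proj G s (x + y) = gm_proj G s x + gm_proj G s y.
  by have := gm_proj_linear G s 1 x y; rewrite !scale1r.
have QZ a (x : E p) : gm_proj G s (a *: x) = a *: gm_proj G s x.
  by have := gm_proj_linear G s a x 0; rewrite Q0 !addr0.
have QN (x : E p) : gm_proj G s (- x) = - gm_proj G s x.
  by rewrite -scaleN1r QZ scaleN1r.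
have KF w : K w -> K (cplx_end (F p) w).
  by case=> w1 w2; split; rewrite /= gm_proj_comm// ?w1 ?w2 linear0.
have KD w w' : K w -> K w' -> K (w + w').
  by case=> w1 w2 [w1' w2']; split; rewrite /= QD ?w1 ?w2 ?w1' ?w2' addr0.
have KZ a w : K w -> K (a *: w).
  by case=> w1 w2; split; rewrite /= ?QD ?QN !QZ w1 w2 !scaler0 ?oppr0 addr0.
have Kz : K z by split; apply: gm_proj_part ss'.
apply: (KZ _ (- cplx_end (F p) (cplx_end (F p) z) - e *: cplx_end (F p) z)).
rewrite -scaleN1r -[- (e *: _)]scaleN1r.
apply: (KD _ _ (KZ _ _ (KF _ (KF _ Kz)))).
exact: KZ (KZ _ _ (KF _ Kz)).
Qed.

Lemma eta_split_eq0 s s' p (x y z : cplx (E p)) : s <> s' ->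
  (gm_part G s' x.1 /\ gm_part G s' x.2) \/ (gm_part G s' z.1 /\ gm_part G s' z.2) ->
  eta_field F (@split_tensor _ _ _ _ _ G S s) x y z = 0.
Proof.
move=> ss' h; rewrite /eta_field /eta_form.
set px := eigen_proj _ _ x; set py := eigen_proj _ _ y; set qz := eigen_proj _ _ z.
suff -> : cplx_tri (@split_tensor _ _ _ _ _ G S s p) px py qz = 0 by rewrite mulr0.
rewrite /cplx_tri /split_tensor.
case: h => [[x1 x2]|[x1 x2]].
  have [-> ->] := eigen_proj_part 'i%C x1 x2 ss'.
  rewrite !(tri0l (@S3 p)).
  by rewrite !subr0 !addr0.
have [-> ->] := eigen_proj_part (- 'i%C) x1 x2 ss'.
rewrite !(tri0r (@S3 p)).
by rewrite !subr0 !addr0.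
Qed.

End SplitKills.

(** * The relations between two connections *)

Theorem theorem13 (R : realType) (n : nat) (M : smooth_manifold R n) (r : nat)
    (E : courant_algebroid M r) (hE : odd_exact E) :
  (forall F : endo_field E, Bn_complex F ->
   forall D D' : gen_connection E,
     Bn_complex_connection F D -> Bn_complex_connection F D' ->
   exists eta : cform3 E,
     S2_section (L_decomp F) SumL SumLbar eta /\
     shifted_by D D' (Re_form (sk eta))) /\
  (forall (G : gen_metric E) (F : endo_field E), pseudo_Kahler G F ->
   forall D D' : gen_connection E,
     Bn_Kahler_connection G F D -> Bn_Kahler_connection G F D' ->
   exists eta_p eta_m : cform3 E,
     [/\ S2_section (Kahler_decomp G F) (KSum true) (KSumbar true) eta_p,
         S2_section (Kahler_decomp G F) (KSum false) (KSumbar false) eta_m &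
         shifted_by D D'
           (Re_form (sk (fun p x y z => eta_p p x y z + eta_m p x y z)))]).
Proof.
split.
- move=> F [aF _] D D' [tD pD] [tD' pD'].
  have [Fskew _ _] := aF.
  have S3 := @diff_tensor_linear _ _ _ _ _ D D'.
  have Ssk := @diff_tensor_skew _ _ _ _ _ D D'.
  have Scy := diff_tensor_cyclic tD tD'.
  have SF := diff_tensor_endo Fskew pD pD'.
  have F3 p x : F p (F p (F p x)) = - F p x.
    have [u0 [l [Fu0 FF]]] := Bn_almost_complex_fibre aF p.
    exact: almost_complex_cube Fu0 FF x.
  exists (eta_field F (diff_tensor D D')); split.
    apply: eta_field_S2 => //; first exact: diff_tensor_smooth.
    (* The projection onto L kills Lbar and U; below, the projection onto Lbar kills L and U. *)
    - case=> // _ p x y z h; apply: eta_field_eq0l => //.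
        exact: eigen_proj_Lbar.
      exact: eigen_proj_ker.
    - case=> // _ p x y z h; apply: eta_field_eq0r => //.
        exact: eigen_proj_L.
      exact: eigen_proj_ker.
  apply: diff_tensor_shifted => p x y z.
  have [u0 [l [Fu0 FF]]] := Bn_almost_complex_fibre aF p.
  apply: Re_sk_eta_form; [exact: S3|exact: Ssk|exact: Scy|exact: SF|].
  exact: (tri_kills_kernel Fu0 FF (S3 p) (@Ssk p) (@SF p)).
- move=> G F [aF GF _ _] D D' [tD mD pD] [tD' mD' pD'].
  have [Fskew _ _] := aF.
  have S3 := @diff_tensor_linear _ _ _ _ _ D D'.
  have Ssk := @diff_tensor_skew _ _ _ _ _ D D'.
  have Scy := diff_tensor_cyclic tD tD'.
  have SF := diff_tensor_endo Fskew pD pD'.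
  have SG := diff_tensor_metric (gm_end_sym G) mD mD'.
  pose T s := @split_tensor _ _ _ _ _ G (diff_tensor D D') s.
  have T3 s p : trilinear_form (@T s p) by exact: split_tensor_linear.
  have Tsk s p x y z : @T s p x y z = - T s p x z y by exact: Ssk.
  have Tcy s p x y z : @T s p x y z + T s p y z x + T s p z x y = 0 by exact: Scy.
  have TF s p x y z : @T s p x (F p y) z = - T s p x y (F p z).
    by rewrite /T /split_tensor !gm_proj_comm// SF.
  have F3 p x : F p (F p (F p x)) = - F p x.
    have [u0 [l [Fu0 FF]]] := Bn_almost_complex_fibre aF p.
    exact: almost_complex_cube Fu0 FF x.
  have TS2 s : S2_section (Kahler_decomp G F) (KSum s) (KSumbar s) (eta_field F (T s)).
    apply: eta_field_S2 => //.
    - by apply: split_tensor_smooth; exact: diff_tensor_smooth.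
    (* The summand in L of opposite sign is killed by [gm_proj s], both conjugate summands by the
       projection onto L, and U by either eigenprojection. *)
    - case=> [s'|s'|] ns p x y z h.
      + case: h => h1 h2 _; apply: (@eta_split_eq0 _ _ _ _ _ G F GF _ S3 s s') => //;
          last by left.
        by move=> ss; apply: ns; rewrite ss.
      + by case: h => _ _ h; apply: eta_field_eq0l => //; exact: eigen_proj_Lbar.
      + by apply: eta_field_eq0l => //; exact: eigen_proj_ker.
    - case=> [s'|s'|] ns p x y z h.
      + by case: h => _ _ h; apply: eta_field_eq0r => //; exact: eigen_proj_L.
      + case: h => h1 h2 _; apply: (@eta_split_eq0 _ _ _ _ _ G F GF _ S3 s s') => //.
          by move=> ss; apply: ns; rewrite ss.
        (* Membership of the conjugate concerns [- z.2]; the part is stable under sign change. *)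
        right; split => //; move: h2; rewrite /cplx_conj /=.
        case: (s') => /= h2; last by rewrite -memvN.
        by move=> y' /h2; rewrite linearNl => /eqP; rewrite oppr_eq0 => /eqP.
      + by apply: eta_field_eq0r => //; exact: eigen_proj_ker.
  exists (eta_field F (T true)), (eta_field F (T false)); split => //.
  apply: diff_tensor_shifted => p x y z.
  have [u0 [l [Fu0 FF]]] := Bn_almost_complex_fibre aF p.
  (* The difference is the sum of its restrictions to [E_+] and [E_-], and each satisfies the
     hypotheses of the fibrewise formula for [Re (sk eta)]. *)
  rewrite -(@split_tensor_sum _ _ _ _ _ G (diff_tensor D D') p x y z
    (S3 p) (@Ssk p) (@Scy p) (@SG p)).
  have ReT s : Re_form (sk (eta_field F (T s))) x y z = T s p x y z.
    apply: Re_sk_eta_form; [exact: T3|exact: Tsk|exact: Tcy|exact: TF|].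
    exact: (tri_kills_kernel Fu0 FF (T3 s p) (@Tsk s p) (@TF s p)).
  rewrite -/(T true p x y z) -/(T false p x y z) -!ReT /Re_form /sk.
  by rewrite opprD addrACA raddfD.
Qed.
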